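(* Let $\mathcal{M}$ be an $n$-dimensional smooth manifold with a volume form $\epsilon\in\Omega^n(\mathcal{M})$ (nowhere vanishing; integration uses the orientation it defines). Let $(\Bbbk,\mathbb{A},\kappa)$ be a smooth deformation of $\mathcal{M}$ and let $\pi$ be the Poisson bivector field on $\mathcal{M}$ determined by it. Suppose that there exists a $\Bbbk$-linear trace $\tau:\mathbb{A}\to\Bbbk$ (i.e. $\tau(ab)=\tau(ba)$ for all $a,b\in\mathbb{A}$) such that $$\int_{\mathcal{M}} f\,\epsilon = \tau(a) \bmod \kappa$$ for all $a\in\mathbb{A}$ with $f=a\bmod\kappa\in C^\infty_{\mathrm c}(\mathcal{M})$. Then $$d(\pi\lrcorner\epsilon)=0,$$ or equivalently, $\pi$ has zero divergence: $\nabla_j\pi^{ij}=0$ for any torsion-free connection $\nabla$ such that $\nabla\epsilon=0$.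
   Context: Functions are $\mathbb{C}$-valued; $C^\infty_{\mathrm c}(\mathcal{M})$ is the algebra of compactly supported smooth functions. Smooth deformation (to second order) of $\mathcal{M}$: a commutative (unital) $\mathbb{C}$-algebra $\Bbbk$, an associative (possibly nonunital, noncommutative) $\Bbbk$-algebra $\mathbb{A}$ (i.e. a $\Bbbk$-module with $\Bbbk$-bilinear multiplication), an element $\kappa\in\Bbbk$, and an algebra isomorphism $C^\infty_{\mathrm c}(\mathcal{M})\cong\mathbb{A}/\kappa\mathbb{A}$, such that $\mathbb{A}/\kappa^3\mathbb{A}$ is a free $\mathbb{C}[\kappa]/\kappa^3$-module. For $a\in\mathbb{A}$, $a\bmod\kappa$ denotes its class in $\mathbb{A}/\kappa\mathbb{A}\cong C^\infty_{\mathrm c}(\mathcal{M})$. For $z\in\mathbb{C}$ and $t\in\Bbbk$, ''$z=t\bmod\kappa$'' means $t-z\cdot 1\in\kappa\Bbbk$. Poisson structure of the deformation: by freeness, multiplication by $\kappa$ identifies $\kappa\mathbb{A}/\kappa^2\mathbb{A}$ canonically with $C^\infty_{\mathrm c}(\mathcal{M})$. For $f=a\bmod\kappa$ and $g=b\bmod\kappa$, the Poisson bracket $\{f,g\}\in C^\infty_{\mathrm c}(\mathcal{M})$ is the unique function with $\kappa\{f,g\}=i(ab-ba)\bmod\kappa^2$. It is well defined, bilinear, antisymmetric, a derivation in each argument and satisfies the Jacobi identity; hence there is a (a priori complex-valued) bivector field $\pi\in\Gamma(\mathcal{M},\wedge^2T\mathcal{M})$ with $\{f,g\}=\pi(df,dg)=\pi^{ij}\,df_i\,dg_j$.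 Contraction: $\pi\lrcorner\epsilon$ is the $(n-2)$-form $(\pi\lrcorner\epsilon)_{ij\cdots}=\tfrac12\pi^{ab}\epsilon_{abij\cdots}$, so that $(X\wedge Y)\lrcorner\epsilon=\epsilon(X,Y,\dots)$. *)

(* Defs.v *)
(* Smooth manifolds are given by a smooth atlas modelled on 'rV[R]_n, for
   R : realType, and tensor fields are given classically: a family of component
   functions, one for every chart, which are smooth and obey the transformation
   law of the tensor type.  All fields have values in R[i]. *)
From HB Require Import structures.
From mathcomp Require Import all_boot all_order all_algebra all_fingroup.
From mathcomp Require Import complex.
From mathcomp Require Import all_classical all_reals all_analysis.

Set Implicit Arguments.
Unset Strict Implicit.
Unset Printing Implicit Defensive.

Import Order.TTheory GRing.Theory Num.Theory.
Import numFieldNormedType.Exports.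

Local Open Scope classical_set_scope.
Local Open Scope ring_scope.
Local Open Scope complex_scope.

Section Euclidean.
Context {R : realType}.

Definition pderiv n (i : 'I_n) (f : 'rV[R]_n -> R) : 'rV[R]_n -> R :=
  fun x => 'D_(delta_mx 0 i) f x.

(* Meant for open U.  Continuity is asked at every level, so that for n = 0 or
   k = 0 nothing is lost. *)
Fixpoint Ck n (k : nat) (U : set 'rV[R]_n) (f : 'rV[R]_n -> R) : Prop :=
  (forall x, U x -> {for x, continuous f}) /\
  if k is k'.+1 then
    forall i : 'I_n,
      (forall x, U x -> derivable f x (delta_mx 0 i)) /\ Ck k' U (pderiv i f)
  else True.

Definition smooth n (U : set 'rV[R]_n) (f : 'rV[R]_n -> R) : Prop :=
  forall k, Ck k U f.

Definition smoothC n (U : set 'rV[R]_n) (f : 'rV[R]_n -> R[i]) : Prop :=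
  smooth U (fun x => complex.Re (f x)) /\ smooth U (fun x => complex.Im (f x)).

Definition pderivC n (i : 'I_n) (f : 'rV[R]_n -> R[i]) : 'rV[R]_n -> R[i] :=
  fun x => pderiv i (fun y => complex.Re (f y)) x
           +i* pderiv i (fun y => complex.Im (f y)) x.

(* The Lebesgue integral over R^n as an iterated integral; it is only applied
   to continuous compactly supported functions, for which Fubini's theorem
   makes the order of integration irrelevant. *)
Fixpoint integral_Rn n : ('rV[R]_n -> R) -> R :=
  match n return ('rV[R]_n -> R) -> R with
  | 0 => fun f => f 0
  | n'.+1 => fun f =>
      Rintegral (@lebesgue_measure R) setT
        (fun t : R => integral_Rn
           (fun y : 'rV[R]_n' => f (row_mx (const_mx t : 'rV[R]_1) y)))
  end.

End Euclidean.

(* [chart_param c] is the inverse of the coordinate map [chart_coord c] of the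
   chart c; [chart_coord c] is only meaningful on [chart_dom c], and
   [chart_param c] on the coordinate range [chart_coord c @` chart_dom c]. *)
Record manifold (R : realType) (n : nat) := Manifold {
  carrier :> topologicalType;
  charts : Type;
  chart_dom : charts -> set carrier;
  chart_coord : charts -> carrier -> 'rV[R]_n;
  chart_param : charts -> 'rV[R]_n -> carrier;
  manifold_hausdorff : hausdorff_space carrier;
  manifold_second_countable : @second_countable carrier;
  chart_dom_open : forall c, open (chart_dom c);
  chart_range_open : forall c, open (chart_coord c @` chart_dom c);
  chart_coordK : forall c p,
    chart_dom c p -> chart_param c (chart_coord c p) = p;
  chart_coord_cts : forall c p,
    chart_dom c p -> {for p, continuous (chart_coord c)};
  chart_param_cts : forall c x,
    (chart_coord c @` chart_dom c) x -> {for x, continuous (chart_param c)};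
  charts_cover : forall p, exists c, chart_dom c p;
  charts_smooth : forall (c c' : charts) (i : 'I_n),
    smooth (chart_coord c @` (chart_dom c `&` chart_dom c'))
      (fun x => chart_coord c' (chart_param c x) 0 i)
}.

Section Fields.
Context {R : realType} {n : nat} (M : manifold R n).
Implicit Types (c : charts M) (p : M) (f g h : M -> R[i]).

Definition range_of c : set 'rV[R]_n := chart_coord c @` chart_dom c.

Definition smooth_in c f : Prop :=
  smoothC (range_of c) (fun x => f (chart_param c x)).

Definition partial c (i : 'I_n) f : M -> R[i] :=
  fun p => pderivC i (fun x => f (chart_param c x)) (chart_coord c p).

Definition closed_support (T : eqType) (z : T) (f : M -> T) : set M :=
  closure [set p | f p != z].

Definition Cc_smooth f : Prop :=
  (forall c, smooth_in c f) /\ compact (closed_support 0 f).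

(* d x'^a / d x^i, for the coordinates x of c and x' of c' *)
Definition jac c c' (a i : 'I_n) p : R :=
  pderiv i (fun x => chart_coord c' (chart_param c x) 0 a) (chart_coord c p).

(* d^2 x'^a / d x^i d x^j *)
Definition jac2 c c' (a i j : 'I_n) p : R :=
  pderiv i (pderiv j (fun x => chart_coord c' (chart_param c x) 0 a))
    (chart_coord c p).

(* Components omega_{I 0, ..., I (k-1)} of a covariant tensor. *)
Definition covariant (k : nat) :=
  charts M -> {ffun 'I_k -> 'I_n} -> M -> R[i].

Definition is_form k (w : covariant k) : Prop :=
  [/\ forall c I, smooth_in c (w c I),
      forall c (I : {ffun 'I_k -> 'I_n}) (s : 'S_k) p, chart_dom c p ->
        w c [ffun l => I (s l)] p = (-1) ^+ s * w c I p
    & forall c c' I p, chart_dom c p -> chart_dom c' p ->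
        w c I p = \sum_(J : {ffun 'I_k -> 'I_n})
                    (\prod_l jac c c' (J l) (I l) p)%:C * w c' J p].

Definition is_volume_form (e : covariant n) : Prop :=
  [/\ is_form e,
      forall c I p, chart_dom c p -> complex.Im (e c I p) = 0
    & forall c p, chart_dom c p -> exists I, e c I p != 0].

Definition ext_d k (w : covariant k) : covariant k.+1 :=
  fun c I p =>
    \sum_(j < k.+1)
      (-1) ^+ j * partial c (I j) (w c [ffun l => I (lift j l)]) p.

Definition bivector := charts M -> 'I_n -> 'I_n -> M -> R[i].

Definition is_bivector (P : bivector) : Prop :=
  [/\ forall c i j, smooth_in c (P c i j),
      forall c i j p, chart_dom c p -> P c j i p = - P c i j p
    & forall c c' a b p, chart_dom c p -> chart_dom c' p ->
        P c' a b p =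
          \sum_i \sum_j (jac c c' a i p * jac c c' b j p)%:C * P c i j p].

Definition icons k (a : 'I_n) (I : {ffun 'I_k -> 'I_n}) :
    {ffun 'I_k.+1 -> 'I_n} :=
  [ffun l => if unlift ord0 l is Some l' then I l' else a].

(* Forms of degree 0 and 1 contract to 0. *)
Definition contract_form (P : bivector) k : covariant k -> covariant k.-2 :=
  match k return covariant k -> covariant k.-2 with
  | k'.+2 => fun w c I p =>
      2^-1 * \sum_a \sum_b P c a b p * w c (icons a (icons b I)) p
  | _ => fun _ _ _ _ => 0
  end.

(* Christoffel symbols [G c i j k] = Gamma^i_{jk} of a connection on the
   (complexified) tangent bundle, nabla_j X^i = d_j X^i + Gamma^i_{jk} X^k. *)
Definition christoffel := charts M -> 'I_n -> 'I_n -> 'I_n -> M -> R[i].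

Definition is_connection (G : christoffel) : Prop :=
  (forall c i j k, smooth_in c (G c i j k)) /\
  (forall c c' i j k p, chart_dom c p -> chart_dom c' p ->
     G c i j k p =
     \sum_a (jac c' c i a p)%:C *
       (\sum_b \sum_d (jac c c' b j p * jac c c' d k p)%:C * G c' a b d p
        + (jac2 c c' a j k p)%:C)).

Definition torsion_free (G : christoffel) : Prop :=
  forall c i j k p, chart_dom c p -> G c i j k p = G c i k j p.

Definition nabla_form (G : christoffel) k (w : covariant k)
    (c : charts M) (j : 'I_n) (I : {ffun 'I_k -> 'I_n}) (p : M) : R[i] :=
  partial c j (w c I) p
  - \sum_(l < k) \sum_m
      G c m j (I l) p * w c [ffun l' => if l' == l then m else I l'] p.

Definition nabla_bivector (G : christoffel) (P : bivector)
    (c : charts M) (l i j : 'I_n) (p : M) : R[i] :=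
  partial c l (P c i j) p
  + \sum_m G c i l m p * P c m j p + \sum_m G c j l m p * P c i m p.

(* For f supported in chart_dom c, the integral of f times the n-form e, M being
   oriented by e: in a chart of either orientation this is the integral of
   f |e_{0 1 ... n-1}|. *)
Definition chart_integral (e : covariant n) c f : R[i] :=
  let density p := `|complex.Re (e c [ffun l => l] p)| in
  let extend (g : M -> R) :=
    patch (fun=> 0) (range_of c) (fun x => g (chart_param c x)) in
  integral_Rn (extend (fun p => complex.Re (f p) * density p))
  +i* integral_Rn (extend (fun p => complex.Im (f p) * density p)).

(* z is the integral over M of f e, for f in Cc_smooth: it is computed by a
   smooth partition of unity on the support of f, subordinate to charts.  The
   value z does not depend on the charts and the partition. *)
Definition is_integral (e : covariant n) f (z : R[i]) : Prop :=
  exists (m : nat) (c : 'I_m -> charts M) (rho : 'I_m -> M -> R),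
    [/\ forall i c', smooth (range_of c') (fun x => rho i (chart_param c' x)),
        forall i p, 0 <= rho i p,
        forall i, compact (closed_support 0 (rho i)) /\
                  closed_support 0 (rho i) `<=` chart_dom (c i),
        forall p, closed_support 0 f p -> \sum_i rho i p = 1
      & z = \sum_i chart_integral e (c i) (fun p => (rho i p)%:C * f p)].

End Fields.

Definition congr_mod (k : comPzRingType) (A : lmodType k) (t : k) (a b : A) :
    Prop :=
  exists d, a - b = t *: d.

(* [scal z] is z%:A for the C-algebra k, and [redk a] is the function a mod kap:
   the composite of A -> A / kap A with the isomorphism of A / kap A with the
   algebra of compactly supported smooth functions.  In [defo_free], an element
   of C[kap]/kap^3 is given by its coefficients of 1, kap, kap^2, and [e] is a
   family in A whose classes are a basis of A / kap^3 A. *)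
Record deformation (R : realType) (n : nat) (M : manifold R n) := Deformation {
  base : comPzRingType;
  scal : {rmorphism R[i] -> base};
  kap : base;
  alg : lmodType base;
  amul : alg -> alg -> alg;
  amulA : associative amul;
  amul_linear_l : forall t a a' b,
    amul (t *: a + a') b = t *: amul a b + amul a' b;
  amul_linear_r : forall t a b b',
    amul a (t *: b + b') = t *: amul a b + amul a b';
  redk : alg -> M -> R[i];
  redk_linear : forall z a b p,
    redk (scal z *: a + b) p = z * redk a p + redk b p;
  redk_mul : forall a b p, redk (amul a b) p = redk a p * redk b p;
  redk_image : forall f, Cc_smooth f <-> exists a, redk a = f;
  redk_kernel : forall a, (forall p, redk a p = 0) <-> congr_mod kap a 0;
  defo_free : exists (B : eqType) (e : B -> alg),
    let comb (s : seq B) (x : B -> 'I_3 -> R[i]) :=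
      \sum_(i <- s) (\sum_(r < 3) scal (x i r) * kap ^+ r) *: e i in
    (forall a, exists s x, uniq s /\ congr_mod (kap ^+ 3) a (comb s x)) /\
    (forall s x, uniq s -> congr_mod (kap ^+ 3) (comb s x) 0 ->
       forall i r, i \in s -> x i r = 0)
}.

Section Poisson.
Context {R : realType} {n : nat} {M : manifold R n} (D : deformation M).

(* h = {f, g} *)
Definition is_poisson_bracket (f g h : M -> R[i]) : Prop :=
  exists a b c : alg D,
    [/\ redk a = f, redk b = g, redk c = h
      & congr_mod (kap D ^+ 2) (kap D *: c)
          (scal D 'i *: (amul a b - amul b a))].

Definition is_poisson_bivector (P : bivector M) : Prop :=
  is_bivector P /\
  (forall f g h, is_poisson_bracket f g h ->
     forall (c : charts M) p, chart_dom c p ->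
       h p = \sum_i \sum_j P c i j p * partial c i f p * partial c j g p).

Definition is_trace (tau : {linear alg D -> (base D)^o}) : Prop :=
  forall a b, tau (amul a b) = tau (amul b a).

(* z = t mod kap *)
Definition is_mod_kap (z : R[i]) (t : base D) : Prop :=
  exists s, t - scal D z = kap D * s.

End Poisson.

Arguments is_mod_kap {R n M} D z t.

(* Main.v *)
(* For test functions f, g the trace property gives kap tau(c) = 0 whenever
   c lifts {f, g}, so kap z lies in the ideal (kap^2) for z the integral of
   {f, g}; by freeness z = 0.  With f a bump in a chart and g equal to the
   coordinate x^k near its support, this says that the integral of
   e P^{ik} d_i f vanishes, i.e. that e P^{ik} is weakly divergence free, e being
   the component of the volume form; hence d_i (e P^{ik}) = 0.  The two forms of
   the conclusion are algebraic consequences. *)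
Require Import Defs.
From HB Require Import structures.
From mathcomp Require Import all_boot all_order all_algebra all_fingroup.
From mathcomp Require Import complex ring lra.
From mathcomp Require Import all_classical all_reals all_analysis.

Set Implicit Arguments.
Unset Strict Implicit.
Unset Printing Implicit Defensive.

Import Order.TTheory GRing.Theory Num.Theory.
Import numFieldNormedType.Exports.

Local Open Scope classical_set_scope.
Local Open Scope ring_scope.
Local Open Scope complex_scope.

(** * Functions of class C^k on open subsets of R^n *)

(** Freeness concerns [alg], whereas the trace only yields a relation in [base]. The bridge is
    indirect: a nonzero integral [z] could be inverted, so that [kap] would be a multiple of
    [kap ^+ 2]; then no basis element can exist, every [redk a] is zero, and [z] is the integral of
    the zero function after all.

    Test functions are built from coordinates and one-variable functions of a squared distance in
    one chart, then extended by zero to [M]. In another chart they become compositions with a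
    transition map, so their smoothness is proved in composed form, and only one-variable outer
    functions need a chain rule. Integration by parts comes from translation invariance and
    difference quotients, which treats all coordinates alike and never exchanges two integrations.

    The integral contains the absolute value of the density, the conclusion the density itself: the
    test is made on a ball where the density has constant sign. Real and imaginary parts of [P] are
    separated, since the passage from weak to pointwise vanishing uses positivity of an integral. *)

Section Ck_calculus.
Context {R : realType} {n : nat}.
Implicit Types (U V : set 'rV[R]_n) (f g u : 'rV[R]_n -> R) (i : 'I_n).

Lemma near_open U (P : set 'rV[R]_n) x :
  open U -> U x -> (forall y, U y -> P y) -> \forall y \near x, P y.
Proof.
move=> oU Ux UP; have : \forall y \near x, U y by exact: open_nbhs_nbhs.
by apply: filterS => y /UP.
Qed.

Lemma pderiv_ext U f g i x : open U -> U x -> (forall y, U y -> f y = g y) ->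
  pderiv i f x = pderiv i g x.
Proof. by move=> oU Ux fg; apply: near_eq_derive; exact: near_open oU Ux _. Qed.

Lemma derivable_ext U f g v x : open U -> U x -> (forall y, U y -> f y = g y) ->
  derivable f x v -> derivable g x v.
Proof.
by move=> oU Ux fg; apply: near_eq_derivable; exact: near_open oU Ux _.
Qed.

Lemma cts_ext U f g x : open U -> U x -> (forall y, U y -> f y = g y) ->
  {for x, continuous f} -> {for x, continuous g}.
Proof.
move=> oU Ux fg; rewrite /prop_for /continuous_at -(fg x Ux); apply: cvg_trans.
have : \forall y \near x, f y = g y by exact: near_open oU Ux fg.
by move=> h; exact: (near_eq_cvg h).
Qed.

Lemma Ck_cts k U f x : Ck k U f -> U x -> {for x, continuous f}.
Proof. by case: k => [|k] [cf _]; exact: cf. Qed.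

Lemma Ck_ext k U f g : open U -> (forall x, U x -> f x = g x) ->
  Ck k U f -> Ck k U g.
Proof.
move=> oU; elim: k f g => [|k IH] f g fg /= [cf df]; split => //.
1,2: by move=> x Ux; exact: (cts_ext oU Ux fg (cf x Ux)).
- move=> i; have [dfi Cfi] := df i; split.
    by move=> x Ux; exact: (derivable_ext oU Ux fg (dfi x Ux)).
  by apply: IH Cfi => x Ux; exact: pderiv_ext oU Ux fg.
Qed.

(** Serves functions given by different formulas on overlapping open sets, such as a bump extended
    by zero: each formula is treated on its own set. *)
Lemma Ck_local k U f :
  (forall x, U x -> exists V, [/\ open V, V x & Ck k V f]) -> Ck k U f.
Proof.
elim: k f => [|k IH] f H /=; split => //.
- by move=> x /H[V [_ Vx /Ck_cts]]; apply.
- by move=> x /H[V [_ Vx /Ck_cts]]; apply.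
- move=> i; split.
    by move=> x /H[V [_ Vx [_ /(_ i)[]]]] + _; apply.
  apply: IH => x /H[V [oV Vx [_ /(_ i)[_ ?]]]].
  by exists V.
Qed.

Lemma Ck_sub k U V f : V `<=` U -> Ck k U f -> Ck k V f.
Proof.
move=> VU; elim: k f => [|k IH] f /= [cf df]; split => //.
- by move=> x /VU; exact: cf.
- by move=> x /VU; exact: cf.
- move=> i; have [dfi Cfi] := df i; split; last exact: IH.
  by move=> x /VU; exact: dfi.
Qed.

Lemma Ck_pred k U f : Ck k.+1 U f -> Ck k U f.
Proof.
elim: k f => [|k IH] f [cf df]; first by [].
by split=> // i; have [dfi Cfi] := df i; split => //; exact: IH.
Qed.

Lemma Ck_derivable k U f i x :
  Ck k.+1 U f -> U x -> derivable f x (delta_mx 0 i).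
Proof. by case=> _ /(_ i)[] + _ Ux; apply. Qed.

Arguments Ck_derivable {k U f} i {x}.

Lemma Ck_pderiv k U f i : Ck k.+1 U f -> Ck k U (pderiv i f).
Proof. by case=> _ /(_ i)[]. Qed.

Lemma Ck_cst k U (a : R) : open U -> Ck k U (fun=> a).
Proof.
move=> oU; elim: k a => [|k IH] a /=; split => //;
  try by move=> x _; exact: (@cst_continuous _ R a x).
move=> i; split => [x _|]; first exact: derivable_cst.
apply: (@Ck_ext _ _ (fun=> 0)) => // x _.
by rewrite /pderiv derive_cst.
Qed.

Lemma CkD k U f g : open U -> Ck k U f -> Ck k U g ->
  Ck k U (fun x => f x + g x).
Proof.
move=> oU; elim: k f g => [|k IH] f g Cf Cg /=; split => //.
1,2: by move=> x Ux; exact: (continuousD (Ck_cts Cf Ux) (Ck_cts Cg Ux)).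
move=> i; split => [x Ux|].
  exact: (derivableD (Ck_derivable i Cf Ux) (Ck_derivable i Cg Ux)).
apply: (@Ck_ext _ _ (fun x => pderiv i f x + pderiv i g x)) => // [x Ux|].
  by rewrite /pderiv -(deriveD (Ck_derivable i Cf Ux) (Ck_derivable i Cg Ux)).
by apply: IH; exact: Ck_pderiv.
Qed.

Lemma CkM k U f g : open U -> Ck k U f -> Ck k U g ->
  Ck k U (fun x => f x * g x).
Proof.
move=> oU; elim: k f g => [|k IH] f g Cf Cg /=; split => //.
1,2: by move=> x Ux; exact: (continuousM (Ck_cts Cf Ux) (Ck_cts Cg Ux)).
move=> i; split => [x Ux|].
  exact: (derivableM (Ck_derivable i Cf Ux) (Ck_derivable i Cg Ux)).
apply: (@Ck_ext _ _ (fun x => f x * pderiv i g x + g x * pderiv i f x)) => // [x Ux|].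
  by rewrite /pderiv (deriveM (Ck_derivable i Cf Ux) (Ck_derivable i Cg Ux)).
by apply: CkD => //; apply: IH; (try exact: Ck_pderiv); exact: Ck_pred.
Qed.

Lemma Ck_sum (I : Type) (r : seq I) k U (f : I -> 'rV[R]_n -> R) : open U ->
  (forall j, Ck k U (f j)) -> Ck k U (fun x => \sum_(j <- r) f j x).
Proof.
move=> oU Cf; elim: r => [|j r IH].
  apply: (@Ck_ext _ _ (fun=> 0)) => // [x _|]; first by rewrite big_nil.
  exact: Ck_cst.
apply: (@Ck_ext _ _ (fun x => f j x + \sum_(j <- r) f j x)) => // [x _|].
  by rewrite big_cons.
exact: CkD.
Qed.

Lemma CkN k U f : open U -> Ck k U f -> Ck k U (fun x => - f x).
Proof.
move=> oU Cf; apply: (@Ck_ext _ _ (fun x => -1 * f x)) => // [x _|].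
  by rewrite mulN1r.
by apply: CkM => //; exact: Ck_cst.
Qed.

Lemma CkB k U f g : open U -> Ck k U f -> Ck k U g ->
  Ck k U (fun x => f x - g x).
Proof. by move=> oU Cf Cg; apply: CkD => //; exact: CkN. Qed.

Lemma CkV k U f : open U -> (forall x, U x -> f x != 0) -> Ck k U f ->
  Ck k U (fun x => (f x)^-1).
Proof.
move=> oU f0; elim: k => [|k IH] Cf /=; split => //.
1,2: by move=> x Ux; exact: (continuousV (f0 x Ux) (Ck_cts Cf Ux)).
move=> i; split => [x Ux|].
  exact: (derivableV (f0 x Ux) (Ck_derivable i Cf Ux)).
have CV := IH (Ck_pred Cf).
apply: (@Ck_ext _ _ (fun x => - ((f x)^-1 * (f x)^-1 * pderiv i f x))) => // [x Ux|].
  rewrite /pderiv (deriveV (f0 x Ux) (Ck_derivable i Cf Ux)).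
  by rewrite /GRing.scale/= mulNr -exprVn expr2.
by apply: CkN => //; apply: CkM => //; [exact: CkM|exact: Ck_pderiv].
Qed.

Lemma is_derive_coord i j (x : 'rV[R]_n) :
  is_derive x (delta_mx 0 j) (fun x : 'rV[R]_n => x 0 i) ((i == j)%:R : R).
Proof.
split; first by apply: diff_derivable; exact: differentiable_coord.
have /matrixP/(_ 0 i) := derive_mx (@derivable_id _ _ x (delta_mx 0 j)).
by rewrite derive_id !mxE eqxx andTb.
Qed.

Lemma Ck_coord k U i : open U -> Ck k U (fun x => x 0 i).
Proof.
move=> oU; case: k => [|k] /=; split => //.
1,2: by move=> x Ux; exact: coord_continuous.
move=> j; split=> [x Ux|]; first by have [] := is_derive_coord i j x.
apply: (@Ck_ext _ _ (fun=> (i == j)%:R)) => // [x Ux|]; last exact: Ck_cst.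
by rewrite /pderiv; have [_ ->] := is_derive_coord i j x.
Qed.

End Ck_calculus.

(** * Smooth cutoffs built from exp(-1/t) *)

Section flat_function.
Context {R : realType}.
Implicit Types (m : nat) (t : R).

(* The derivatives of exp(-1/t) are combinations of the functions
   t^(-m) exp(-1/t), so smoothness is proved for all m at once. *)
Definition flat m t : R := if 0 < t then t^-1 ^+ m * expR (- t^-1) else 0.

Lemma flat_ge0 m t : 0 <= flat m t.
Proof.
rewrite /flat; case: ifP => // t0.
by rewrite mulr_ge0 ?expR_ge0// exprn_ge0// invr_ge0 ltW.
Qed.

Lemma flat_gt0 m t : 0 < t -> 0 < flat m t.
Proof. by move=> t0; rewrite /flat t0 mulr_gt0 ?expR_gt0// exprn_gt0// invr_gt0. Qed.

Lemma flat_le0 m t : t <= 0 -> flat m t = 0.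
Proof. by rewrite /flat leNgt => /negbTE ->. Qed.

(** With s = 1/t, one term of the exponential series gives s^(m+1) <= (m+1)! exp(s). That is one
    power of s more than [flat m] contains, which leaves the factor t. *)
Lemma flat_bound m t : flat m t <= m.+1`!%:R * `|t|.
Proof.
have [t0|t0] := ltP 0 t; last by rewrite flat_le0// mulr_ge0.
rewrite /flat t0 gtr0_norm//.
have s0 : 0 < t^-1 by rewrite invr_gt0.
have : t^-1 ^+ m.+1 <= m.+1`!%:R * expR t^-1.
  have := expR_ge1Dxn m (ltW s0); rewrite -ler_pdivrMl ?ltr0n ?fact_gt0//.
  by apply: le_trans; rewrite mulrC lerDr.
rewrite expRN => h; rewrite ler_pdivrMr ?expR_gt0// -(ler_pM2r s0) -exprSr.
by apply: le_trans h _; rewrite mulrAC mulfK ?gt_eqF.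
Qed.

Lemma flat_is_derive m t :
  is_derive t 1 (flat m) (flat m.+2 t - m%:R * flat m.+1 t).
Proof.
have [t0|t0|<-] := ltgtP 0 t.
- have near0 : \forall s \near t, s^-1 ^+ m * expR (- s^-1) = flat m s.
    have : \forall s \near t, 0 < s by exact: lt_nbhsr.
    by apply: filterS => s s0; rewrite /flat s0.
  apply: near_eq_is_derive near0 _.
  have dV : is_derive t 1 (fun s : R => s^-1) (- t^-1 ^+ 2).
    have := @is_deriveV R id t 1 1 (lt0r_neq0 t0) (is_derive_id t 1).
    by rewrite /GRing.scale/= mulr1 -exprVn.
  have dE : is_derive t 1 (fun s : R => expR (- s^-1)) (expR (- t^-1) * t^-1 ^+ 2).
    have := @is_derive1_comp _ expR (fun s => - s^-1) t _ _ (is_derive_expR _) (is_deriveN dV).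
    by rewrite opprK.
  have dX : is_derive t 1 (fun s : R => s^-1 ^+ m) (- (m%:R * t^-1 ^+ m.+1)).
    have := is_deriveX m dV; rewrite /GRing.scale/= mulrN -mulrA -exprD.
    case: m => [|m]; first by rewrite !mul0r exprfctE.
    by rewrite addn2 exprfctE.
  have := is_deriveM dX dE; rewrite /flat !t0 /GRing.scale/=.
  move=> D; apply: (is_derive_eq D).
  by rewrite -(addn2 m) -(addn1 m) !exprD; ring.
- have near0 : \forall s \near t, cst 0 s = flat m s.
    have : \forall s \near t, s < 0 by exact: lt_nbhsl.
    by apply: filterS => s /ltW s0; rewrite flat_le0.
  apply: near_eq_is_derive near0 _.
  by rewrite !flat_le0 ?ltW// mulr0 subrr; exact: is_derive_cst.
- rewrite !flat_le0// mulr0 subrr.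
  have lim0 : (fun h => h^-1 *: ((flat m \o shift 0) (h *: 1) - flat m 0)) @ 0^' --> (0 : R).
    apply/cvgrPdist_le => e e0; near=> h.
    rewrite sub0r normrN /= addr0 (flat_le0 m (lexx 0)) subr0 [h%:A]mulr1.
    have [h0|h0] := ltP 0 h; last by rewrite flat_le0// scaler0 normr0 ltW.
    (* The difference quotient at 0 is the next function of the family, so [flat_bound] for [m.+1]
       shows that it tends to 0. *)
    have -> : h^-1 *: flat m h = flat m.+1 h.
      by rewrite /flat h0 exprS -mulrA.
    rewrite ger0_norm ?flat_ge0//; apply: le_trans (flat_bound _ _) _.
    rewrite -ler_pdivlMl ?ltr0n ?fact_gt0//; near: h; apply: dnbhs0_le.
    by rewrite mulr_gt0// invr_gt0 ltr0n fact_gt0.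
  split; first by apply/cvg_ex; exists 0.
  exact: cvg_lim lim0.
Unshelve. all: by end_near. Qed.

(** Along the line through [x] with direction [v], both derivatives become one-variable derivatives
    at 0. Hence only a directional derivative of [u] is required, not its differentiability. *)
Lemma is_derive_comp_dir (V : normedModType R) (h : R -> R) (u : V -> R) x v a b :
  is_derive (u x) 1 h a -> is_derive x v u b ->
  is_derive x v (fun y => h (u y)) (a * b).
Proof.
have line (w : V -> R) c : is_derive x v w c <->
    is_derive 0 (1 : R) (fun s : R => w (s *: v + x)) c.
  have E : 'D_1 (fun s : R => w (s *: v + x)) 0 = 'D_v w x.
    rewrite /derive; set F := fun h => _; set G := fun h => _.
    suff -> : F = G by [].
    apply/funext => s; rewrite /F /G /=.
    by rewrite addr0 scale0r add0r [s%:A]mulr1.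
  split=> -[dw <-].
    by split; [exact: (derivable1P w x v).1|exact: E].
  by split; [exact: (derivable1P w x v).2|exact: esym E].
move=> dh /line du; apply/line; apply: (is_derive1_comp (f := h)) => //.
by rewrite /= scale0r add0r.
Qed.

Lemma Ck_flat n k m (U : set 'rV[R]_n) u : open U -> Ck k U u ->
  Ck k U (fun x => flat m (u x)).
Proof.
move=> oU; elim: k m => [|k IH] m Cu /=.
1,2: have cf t : {for t, continuous (flat m)} by
  apply/differentiable_continuous/derivable1_diffP; have [] := flat_is_derive m t.
1,2: split=> //; first by move=> x Ux; apply: continuous_comp; [exact: Ck_cts Cu Ux|exact: cf].
move=> i.
have dc x : U x -> is_derive x (delta_mx 0 i) (fun y => flat m (u y))
    ((flat m.+2 (u x) - m%:R * flat m.+1 (u x)) * pderiv i u x).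
  move=> Ux; apply: is_derive_comp_dir; first exact: flat_is_derive.
  by apply: derivableP; exact: Ck_derivable Cu Ux.
split=> [x /dc[]//|].
apply: (@Ck_ext _ _ _ _ (fun x =>
  (flat m.+2 (u x) - m%:R * flat m.+1 (u x)) * pderiv i u x)) => //.
  by move=> x /dc[_]; rewrite /pderiv => ->.
apply: CkM => //; last exact: Ck_pderiv.
have Cu' := Ck_pred Cu.
by apply: CkB => //; [exact: IH|apply: CkM => //; [exact: Ck_cst|exact: IH]].
Qed.

(* Equal to 1 for t <= a and to 0 for t >= b. *)
Definition cutoff (a b t : R) := flat 0 (b - t) / (flat 0 (b - t) + flat 0 (t - a)).

Lemma cutoff_denom_gt0 a b t : a < b -> 0 < flat 0 (b - t) + flat 0 (t - a).
Proof.
move=> ab; have [tb|bt] := ltP t b.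
  by rewrite ltr_wpDr ?flat_ge0// flat_gt0// subr_gt0.
by rewrite ltr_wpDl ?flat_ge0// flat_gt0// subr_gt0 (lt_le_trans ab).
Qed.

Lemma cutoff_ge0 a b t : a < b -> 0 <= cutoff a b t.
Proof. by move=> ab; rewrite divr_ge0 ?flat_ge0// ltW// cutoff_denom_gt0. Qed.

Lemma cutoff1 a b t : a < b -> t <= a -> cutoff a b t = 1.
Proof.
move=> ab ta; rewrite /cutoff (@flat_le0 0 (t - a)) ?subr_le0// addr0 divff//.
by rewrite gt_eqF// flat_gt0// subr_gt0 (le_lt_trans ta).
Qed.

Lemma cutoff0 a b t : b <= t -> cutoff a b t = 0.
Proof. by move=> bt; rewrite /cutoff flat_le0 ?subr_le0// mul0r. Qed.

Lemma Ck_cutoff n k a b (U : set 'rV[R]_n) u : a < b -> open U -> Ck k U u ->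
  Ck k U (fun x => cutoff a b (u x)).
Proof.
move=> ab oU Cu; have Cc c : Ck k U (fun=> c) by exact: Ck_cst.
apply: CkM => //; first by apply: Ck_flat => //; exact: CkB.
apply: CkV => //; first by move=> x _; rewrite gt_eqF// cutoff_denom_gt0.
by apply: CkD => //; apply: Ck_flat => //; exact: CkB.
Qed.

End flat_function.

(** * The iterated integral of continuous compactly supported functions *)

Section tame_line.
Context {R : realType}.
Implicit Types (K : R) (g : R -> R).
Local Notation mu := (@lebesgue_measure R).

Lemma fine_lebesgue_seg (a b : R) : a <= b -> fine (mu `[a, b]%classic) = b - a.
Proof.
move=> ab; have -> := lebesgue_measure_itv (Interval (BLeft a) (BRight b)).
rewrite /= lte_fin; case: ltgtP ab => // -> _.
by rewrite subrr.
Qed.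

Definition tame1 K g :=
  (forall eps : R, 0 < eps -> exists2 d : R, 0 < d &
     forall s t, `|s - t| < d -> `|g s - g t| < eps) /\
  (forall t, K < `|t| -> g t = 0).

Lemma tame1_cts K g : tame1 K g -> continuous g.
Proof.
move=> [ug _] t; apply/cvgrPdist_lt => eps /ug[d d0 dP].
by near=> s; apply: dP; near: s; exact: cvgr_dist_lt.
Unshelve. all: by end_near. Qed.

Lemma tame1_restrict K g : tame1 K g -> g \_ `[- K, K] = g.
Proof.
move=> [_ g0]; apply/funext => t; rewrite patchE; case: ifPn => // /negP tK.
rewrite g0// ltNge; apply/negP => tK'; apply: tK.
by rewrite inE/= in_itv/= -ler_norml.
Qed.

Lemma tame1_integrable K g : tame1 K g -> mu.-integrable setT (EFin \o g).
Proof.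
move=> gK; rewrite -(tame1_restrict gK).
have : mu.-integrable `[- K, K]%classic (EFin \o g).
  apply: continuous_compact_integrable; first exact: segment_compact.
  by apply: continuous_subspaceT; exact: tame1_cts gK.
by move=> /integrable_mkcond; rewrite restrict_EFin; apply.
Qed.

Lemma tame1_bound K g (c : R) : 0 <= K -> tame1 K g -> (forall t, `|g t| <= c) ->
  `|Rintegral mu setT g| <= (2 * K) * c.
Proof.
move=> K0 gK gc.
have mK : measurable (`[- K, K]%classic : set (measurableTypeR R)) by exact: measurable_itv.
have ig : mu.-integrable `[- K, K]%classic (EFin \o g).
  by apply: integrableS (tame1_integrable gK).
have -> : Rintegral mu setT g = Rintegral mu `[- K, K]%classic g.
  by rewrite -[in LHS](tame1_restrict gK) [RHS]Rintegral_mkcond.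
apply: le_trans (le_normr_Rintegral mK ig) _.
apply: (@le_trans _ _ (Rintegral mu `[- K, K]%classic (fun=> c))).
  apply: le_Rintegral => //.
  - exact: (integrable_norm ig).
  - apply: (@continuous_compact_integrable R (cst c)); first exact: segment_compact.
    by apply: continuous_subspaceT => x; exact: cst_continuous.
rewrite Rintegral_cst//.
have -> : fine (mu `[- K, K]%classic) = 2 * K.
  by rewrite (fine_lebesgue_seg (a := - K)); lra.
by rewrite mulrC.
Qed.

(** The push-forward of Lebesgue measure under a translation has the same values on half-open
    intervals, so uniqueness identifies the two measures; the rest is the change of variables
    formula. *)
Lemma Rintegral_shift K g s : tame1 K g ->
  Rintegral mu setT (fun t => g (t + s)) = Rintegral mu setT g.
Proof.
move=> gK.
pose phi := (fun t => t + s) : measurableTypeR R -> measurableTypeR R.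
have mphi : measurable_fun setT phi.
  by apply: measurable_realfun.continuous_measurable_fun => t;
    apply: cvgD; [exact: cvg_id|exact: cvg_cst].
have mupush (A : set R) : measurable A -> mu A = pushforward mu phi A.
  apply: lebesgue_measure_unique => _ [[a b]] _ <-.
  suff : lebesgue_measure (`]a, b]%classic : set R) =
      lebesgue_measure (phi @^-1` `]a, b]%classic) by [].
  have -> : phi @^-1` `]a, b]%classic = `]a - s, b - s]%classic.
    by apply/seteqP; split=> t /=; rewrite !in_itv/= ltrBlDr lerBrDr.
  rewrite !lebesgue_measure_itv/= !lte_fin ltrD2r; case: ifP => // _.
  by rewrite !EFinN -!EFinB; congr (_%:E); lra.
rewrite /Rintegral; congr fine.
have shK : tame1 (K + `|s|) (g \o phi).
  split.
    move=> eps /gK.1[d d0 dP]; exists d => // x y xy; apply: dP.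
    by rewrite /phi opprD addrACA subrr addr0.
  move=> t tK; apply: gK.2; rewrite /phi.
  have := ler_normB (t + s) s; rewrite addrK; lra.
have := @integral_pushforward _ _ _ _ R phi mphi mu setT (EFin \o g).
rewrite preimage_setT => <-//.
- by apply: eq_measure_integral => A mA _; exact/esym/mupush.
- apply/measurable_realfun.measurable_EFinP.
  by apply: measurable_realfun.continuous_measurable_fun; exact: tame1_cts gK.
- exact: (tame1_integrable shK).
Qed.

Lemma tame1_gt0 K g t0 : tame1 K g -> (forall t, 0 <= g t) -> 0 < g t0 ->
  0 < Rintegral mu setT g.
Proof.
move=> gK g0 gt0.
have [|d d0 dP] := gK.1 (g t0 / 2); first by lra.
(* On this interval [g] stays above half of [g t0]; the length [d / 2] keeps even its closed end at
   distance less than [d] from [t0]. *)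
pose D : set (measurableTypeR R) := `[t0, t0 + d / 2]%classic.
have mD : measurable D by exact: measurable_itv.
have iD : mu.-integrable D (EFin \o cst (g t0 / 2)).
  apply: (@continuous_compact_integrable R (cst (g t0 / 2))); first exact: segment_compact.
  by apply: continuous_subspaceT => x; exact: cst_continuous.
apply: (@lt_le_trans _ _ (Rintegral mu D (cst (g t0 / 2)))).
  rewrite Rintegral_cst//.
  have -> : fine (mu D) = d / 2 by rewrite (fine_lebesgue_seg (a := t0)); lra.
  by apply: mulr_gt0; lra.
rewrite Rintegral_mkcond; apply: le_Rintegral => //.
- by have := (integrable_mkcond _ mD).1 iD; rewrite restrict_EFin.
- exact: tame1_integrable gK.
- move=> t _; rewrite patchE; case: ifPn => // /set_mem.
  rewrite /D /= in_itv/= => /andP[t1 t2].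
  have /dP : `|t - t0| < d by rewrite ger0_norm; lra.
  by rewrite ltr_norml => /andP[? _]; lra.
Qed.

End tame_line.

Section tame_space.
Context {R : realType}.
Implicit Types (n : nat) (K : R).
Local Notation mu := (@lebesgue_measure R).

(** Uniform continuity in the sup norm and an explicit box for the support pass to every slice with
    the same [d] and [K], so that estimates on slices are uniform in the remaining variable. *)
Definition tame n K (f : 'rV[R]_n -> R) :=
  (forall eps : R, 0 < eps -> exists2 d : R, 0 < d &
     forall x y : 'rV[R]_n, (forall i, `|x 0 i - y 0 i| < d) -> `|f x - f y| < eps) /\
  (forall (x : 'rV[R]_n) i, K < `|x 0 i| -> f x = 0).

Lemma tame_cts n (K : R) (f : 'rV[R]_n -> R) : continuous f ->
  (forall (x : 'rV[R]_n) i, K < `|x 0 i| -> f x = 0) -> tame K f.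
Proof.
move=> cf f0; split => // eps eps0.
(* The margin 1, together with [d <= 1] below, ensures that a point outside [A] and any point
   [d]-close to it both have a coordinate beyond [K], where [f] vanishes. *)
pose A : set 'rV[R]_n := [set x : 'rV[R]_n | forall i, x 0 i \in `[- (K + 1), K + 1]].
have cA : compact A.
  by apply: (@rV_compact _ _ (fun=> `[- (K + 1), K + 1]%classic)) => _; exact: segment_compact.
have /compact_near_coveringP/(_ R (0 : R)^'+ (fun d (x : 'rV[R]_n) =>
   forall y : 'rV[R]_n, (forall i, `|x 0 i - y 0 i| < d) -> `|f x - f y| < eps)) H := cA.
have {}H : \forall d \near (0 : R)^'+, forall x : 'rV[R]_n, A x ->
    forall y : 'rV[R]_n, (forall i, `|x 0 i - y 0 i| < d) -> `|f x - f y| < eps.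
  apply: H => x Ax.
  have /nbhs_ballP[r /= r0 rP] : \forall y \near x, `|f x - f y| < eps / 2.
    by have /cvgrPdist_lt := cf x; apply; lra.
  near=> x' d => y /= x'y.
  have x'r : ball x (r / 2) x' by near: x'; apply: nbhsx_ballx; lra.
  have dr : d <= r / 2 by near: d; apply: nbhs_right_le; lra.
  have fx' : `|f x - f x'| < eps / 2.
    by apply: rP; apply: le_ball x'r; lra.
  have fy : `|f x - f y| < eps / 2.
    apply: rP; split => // i j; have [_ /(_ i j)] := x'r.
    rewrite /ball/= !ord1 => h; have := x'y j => h'.
    rewrite (_ : x 0 j - y 0 j = (x 0 j - x' 0 j) + (x' 0 j - y 0 j)); last by ring.
    by apply: le_lt_trans (ler_normD _ _) _; lra.
  rewrite (_ : f x' - f y = - (f x - f x') + (f x - f y)); last by ring.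
  by apply: le_lt_trans (ler_normD _ _) _; rewrite normrN; lra.
have [d [d0 d1 dA]] : exists d, [/\ 0 < d, d <= 1 & forall x : 'rV[R]_n, A x ->
    forall y : 'rV[R]_n, (forall i, `|x 0 i - y 0 i| < d) -> `|f x - f y| < eps].
  near (0 : R)^'+ => d; exists d; split => //.
    by near: d; apply: nbhs_right_le.
  by near: d.
exists d => // x y xy.
have [|/existsNP[i /negP]] := pselect (A x); first by move=> /dA; apply.
rewrite in_itv/= -ler_norml -ltNge => Ki.
rewrite (f0 x i) ?(f0 y i) ?subrr ?normr0//; last by lra.
have := xy i; have := ler_normD (x 0 i - y 0 i) (y 0 i); rewrite subrK; lra.
Unshelve. all: by end_near. Qed.

Definition slice n (f : 'rV[R]_n.+1 -> R) (t : R) (y : 'rV[R]_n) : R :=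
  f (row_mx (const_mx t : 'rV[R]_1) y).

Lemma row_const0 n t (y : 'rV[R]_n) : (row_mx (const_mx t : 'rV[R]_1) y) 0 ord0 = t.
Proof.
by rewrite (_ : ord0 = lshift n (ord0 : 'I_1)) ?row_mxEl ?mxE//; exact: val_inj.
Qed.

Lemma row_constS n t (y : 'rV[R]_n) j :
  (row_mx (const_mx t : 'rV[R]_1) y) 0 (lift ord0 j) = y 0 j.
Proof.
by rewrite (_ : lift ord0 j = rshift 1 j) ?row_mxEr//; exact: val_inj.
Qed.

Lemma integral_RnS n (f : 'rV[R]_n.+1 -> R) :
  integral_Rn f = Rintegral mu setT (fun t => integral_Rn (slice f t)).
Proof. by []. Qed.

Lemma tame_slice n K (f : 'rV[R]_n.+1 -> R) t : tame K f -> tame K (slice f t).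
Proof.
move=> [uf f0]; split.
  move=> eps /uf[d d0 dP]; exists d => // x y xy; apply: dP => i.
  case: (unliftP ord0 i) => [j ->|->]; first by rewrite !row_constS.
  by rewrite !row_const0 subrr normr0.
by move=> x i Ki; apply: (f0 _ (lift ord0 i)); rewrite row_constS.
Qed.

Lemma tame_lin n K a (f g : 'rV[R]_n -> R) : tame K f -> tame K g ->
  tame K (fun x => a * f x + g x).
Proof.
move=> [uf f0] [ug g0]; split; last first.
  by move=> x i Ki; rewrite (f0 x i)// (g0 x i)// mulr0 addr0.
move=> eps eps0.
have a0 : 0 < `|a| + 1 by rewrite ltr_wpDl.
have [d d0 dP] := uf (eps / 2 / (`|a| + 1)) ltac:(by rewrite !divr_gt0).
have [d' d'0 d'P] := ug (eps / 2) ltac:(by rewrite divr_gt0).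
exists (Num.min d d'); first by rewrite lt_min d0.
move=> x y xy.
have /dP : forall i, `|x 0 i - y 0 i| < d by move=> i; have := xy i; rewrite lt_min => /andP[].
have /d'P : forall i, `|x 0 i - y 0 i| < d' by move=> i; have := xy i; rewrite lt_min => /andP[].
move=> hg hf.
rewrite (_ : _ - _ = a * (f x - f y) + (g x - g y)); last by ring.
apply: le_lt_trans (ler_normD _ _) _; rewrite normrM.
have : `|a| * `|f x - f y| <= eps / 2.
  apply: (@le_trans _ _ ((`|a| + 1) * `|f x - f y|)); first by rewrite ler_wpM2r// lerDl.
  by rewrite mulrC -ler_pdivlMr// ltW.
lra.
Qed.

Lemma tame_cst0 n K : tame K (fun _ : 'rV[R]_n => 0).
Proof. by split => // eps eps0; exists 1 => // x y _; rewrite subrr normr0. Qed.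

(* Boundedness and linearity of the integral are proved together, by induction
   on n: they make the slice integrals continuous, hence integrable. *)
Definition integral_Rn_tame n K :=
  (forall (f : 'rV[R]_n -> R) c, tame K f -> (forall x, `|f x| <= c) ->
     `|integral_Rn f| <= (2 * K) ^+ n * c) /\
  (forall a (f g : 'rV[R]_n -> R), tame K f -> tame K g ->
     integral_Rn (fun x => a * f x + g x) = a * integral_Rn f + integral_Rn g).

Lemma tame1_slice_step n K (f : 'rV[R]_n.+1 -> R) : 0 <= K -> integral_Rn_tame n K ->
  tame K f -> tame1 K (fun t => integral_Rn (slice f t)).
Proof.
move=> K0 [IHb IHl] tf; split.
  move=> eps eps0.
  (* The added 1 keeps the divisor positive even if [K = 0], and makes the final estimate strict. *)
  have C0 : 0 < (2 * K) ^+ n + 1 by rewrite ltr_wpDl// exprn_ge0// mulr_ge0.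
  have [d d0 dP] := tf.1 (eps / ((2 * K) ^+ n + 1)) ltac:(by rewrite divr_gt0).
  exists d => // s t st.
  have -> : integral_Rn (slice f s) - integral_Rn (slice f t) =
      integral_Rn (fun y => -1 * slice f t y + slice f s y).
    by rewrite (IHl (-1) _ _ (tame_slice t tf) (tame_slice s tf)) mulN1r addrC.
  have := IHb _ (eps / ((2 * K) ^+ n + 1)) (tame_lin (-1) (tame_slice t tf) (tame_slice s tf)).
  move=> /(_ _)/le_lt_trans; apply.
    move=> y; rewrite mulN1r addrC; apply/ltW/dP => i.
    case: (unliftP ord0 i) => [j ->|->]; first by rewrite !row_constS subrr normr0.
    by rewrite !row_const0.
  by rewrite mulrA ltr_pdivrMr// mulrC ltr_pM2l// ltrDl.
move=> t Kt; have := IHb (slice f t) 0 (tame_slice t tf).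
rewrite mulr0 normr_le0 => H; apply/eqP/H => y.
by rewrite /slice (tf.2 _ ord0) ?normr0// row_const0.
Qed.

Lemma tame_integral_Rn n K : 0 <= K -> integral_Rn_tame n K.
Proof.
move=> K0; elim: n => [|n IH].
  by split=> // f c _ fc; rewrite expr0 mul1r; exact: fc.
have [IHb IHl] := IH; split=> [f c tf fc|a f g tf tg].
  rewrite integral_RnS exprS -mulrA; apply: tame1_bound => //; first exact: tame1_slice_step.
  by move=> t; apply: IHb; [exact: tame_slice|move=> x; exact: fc].
rewrite !integral_RnS.
under [LHS]eq_Rintegral do rewrite (IHl a _ _ (tame_slice _ tf) (tame_slice _ tg)).
have iF := tame1_integrable (tame1_slice_step K0 IH tf).
have iG := tame1_integrable (tame1_slice_step K0 IH tg).
rewrite RintegralD//=; first by rewrite RintegralZl.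
by have := integrableZl measurableT a iF; apply: eq_integrable.
Qed.

End tame_space.

Section integral_Rn_theory.
Context {R : realType}.
Implicit Types (n : nat) (K : R).
Local Notation mu := (@lebesgue_measure R).

Lemma tame_bound n K (f : 'rV[R]_n -> R) c : 0 <= K -> tame K f ->
  (forall x, `|f x| <= c) -> `|integral_Rn f| <= (2 * K) ^+ n * c.
Proof. by move=> K0; have [+ _] := tame_integral_Rn n K0; apply. Qed.

Lemma integral_Rn_lin n K a (f g : 'rV[R]_n -> R) : 0 <= K -> tame K f -> tame K g ->
  integral_Rn (fun x => a * f x + g x) = a * integral_Rn f + integral_Rn g.
Proof. by move=> K0; have [_] := tame_integral_Rn n K0; apply. Qed.

Lemma integral_Rn0 n : integral_Rn (fun _ : 'rV[R]_n => 0) = 0.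
Proof.
apply/eqP; rewrite -normr_le0.
have := tame_bound (c := 0) (lexx 0) (tame_cst0 n 0); rewrite mulr0; apply.
by move=> x; rewrite normr0.
Qed.

Lemma tame1_slice n K (f : 'rV[R]_n.+1 -> R) : 0 <= K -> tame K f ->
  tame1 K (fun t => integral_Rn (slice f t)).
Proof. by move=> K0; apply: tame1_slice_step => //; exact: tame_integral_Rn. Qed.

Lemma row_const_shift0 n t s (y : 'rV[R]_n) :
  row_mx (const_mx t : 'rV[R]_1) y + s *: delta_mx 0 (ord0 : 'I_n.+1) =
  row_mx (const_mx (t + s) : 'rV[R]_1) y :> 'rV[R]_n.+1.
Proof.
apply/rowP => k; rewrite [LHS]mxE [X in _ + X]mxE [X in _ * X]mxE.
case: (unliftP ord0 k) => [j ->|->]; first by rewrite !row_constS mulr0 addr0.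
by rewrite !row_const0 mulr1.
Qed.

Lemma row_const_shiftS n t s (y : 'rV[R]_n) i :
  row_mx (const_mx t : 'rV[R]_1) y + s *: delta_mx 0 (lift ord0 i : 'I_n.+1) =
  row_mx (const_mx t : 'rV[R]_1) (y + s *: delta_mx 0 i) :> 'rV[R]_n.+1.
Proof.
apply/rowP => k; rewrite [LHS]mxE [X in _ + X]mxE [X in _ * X]mxE.
case: (unliftP ord0 k) => [j ->|->].
  by rewrite !row_constS [RHS]mxE [X in _ = _ + X]mxE [X in _ = _ + _ * X]mxE (inj_eq lift_inj).
by rewrite !row_const0 mulr0 addr0.
Qed.

Lemma integral_Rn_shift n K s (f : 'rV[R]_n -> R) i : 0 <= K -> tame K f ->
  integral_Rn (fun x => f (x + s *: delta_mx 0 i)) = integral_Rn f.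
Proof.
move=> K0; elim: n f i => [f []//|n IH f i tf].
rewrite !integral_RnS; case: (unliftP ord0 i) => [j ->|->].
  apply: eq_Rintegral => t _; rewrite -(IH (slice f t) j (tame_slice t tf)).
  by congr integral_Rn; apply/funext => y; rewrite /slice row_const_shiftS.
rewrite -(Rintegral_shift s (tame1_slice K0 tf)).
apply: eq_Rintegral => t _.
by congr integral_Rn; apply/funext => y; rewrite /slice row_const_shift0.
Qed.

Lemma integral_Rn_ge0 n (f : 'rV[R]_n -> R) : (forall x, 0 <= f x) ->
  0 <= integral_Rn f.
Proof.
elim: n f => [f|n IH f f0]; first exact.
by rewrite integral_RnS; apply: Rintegral_ge0 => t _; apply: IH => y; exact: f0.
Qed.

Lemma integral_Rn_gt0 n K (f : 'rV[R]_n -> R) x : 0 <= K -> tame K f ->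
  (forall x, 0 <= f x) -> 0 < f x -> 0 < integral_Rn f.
Proof.
move=> K0; elim: n f x => [f x _ _|n IH f x tf f0 fx].
  by rewrite /= (_ : 0 = x)//; apply/rowP => -[].
rewrite integral_RnS; apply: (@tame1_gt0 _ K _ (x 0 ord0)).
- exact: tame1_slice.
- by move=> t; apply: integral_Rn_ge0 => y; exact: f0.
- apply: (IH _ (rsubmx (x : 'rV[R]_(1 + n)))); first exact: tame_slice.
    by move=> y; exact: f0.
  rewrite /slice; move: fx; congr (_ < f _); apply/rowP => k.
  case: (unliftP ord0 k) => [j ->|->]; last by rewrite row_const0.
  by rewrite row_constS mxE; congr (x _ _); exact: val_inj.
Qed.

Lemma pderiv_MVT n (f : 'rV[R]_n -> R) i (x : 'rV[R]_n) (s : R) : 0 < s ->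
  (forall x, derivable f x (delta_mx 0 i)) ->
  exists2 r, 0 < r < s &
    f (x + s *: delta_mx 0 i) - f x = s * pderiv i f (x + r *: delta_mx 0 i).
Proof.
move=> s0 df; pose e : 'rV[R]_n := delta_mx 0 i.
pose g (t : R) := f (x + t *: e).
have dg (t : R) : is_derive t 1 g (pderiv i f (x + t *: e)).
  have D := df (x + t *: e).
  have E : (fun h : R => f (h *: e + (x + t *: e))) = g \o shift t.
    by apply/funext => h; rewrite /g /= scalerDl addrCA.
  have /derivable1P := D; rewrite E => D1.
  have dgt : derivable g t 1.
    move: D1; rewrite /derivable; set F := fun h => _; set G := fun h => _.
    rewrite (_ : F = G)//; apply/funext => h.
    by rewrite /F /G /= addr0 add0r.
  split => //; rewrite /pderiv /derive; set F := fun h => _; set G := fun h => _.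
  rewrite (_ : F = G)//; apply/funext => h.
  by rewrite /F /G /g /= [h%:A]mulr1 scalerDl addrCA.
have [|r rs] := @MVT R g (fun t => pderiv i f (x + t *: e)) 0 s s0 (fun t _ => dg t).
  apply: continuous_subspaceT => t.
  by apply/differentiable_continuous/derivable1_diffP; have [] := dg t.
rewrite /g scale0r addr0 subr0 mulrC => E.
by exists r => //; move: rs; rewrite in_itv.
Qed.

(** The integral of f(x + s e) - f(x) is 0 by translation invariance. By the mean value theorem this
    difference is s times the partial derivative at a point closer than [d] to x, hence within s eps
    of s times the derivative at x. Dividing by s bounds the integral of the derivative by a
    constant times eps. *)
Lemma integral_Rn_pderiv n K (f : 'rV[R]_n -> R) i : 0 <= K -> tame K f ->
  (forall x, derivable f x (delta_mx 0 i)) -> tame K (pderiv i f) ->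
  integral_Rn (pderiv i f) = 0.
Proof.
(* The box of half-width [K + 1] contains the supports of [f] and of its translates by [s <= 1]; the
   last 1 makes [C] positive. *)
move=> K0 tf df tdf; pose C := (2 * (K + 1)) ^+ n + 1.
have K1 : 0 <= K + 1 by rewrite addr_ge0.
have C0 : 0 < C by rewrite ltr_wpDl// exprn_ge0// mulr_ge0.
have tameS (g : 'rV[R]_n -> R) : tame K g -> tame (K + 1) g.
  by move=> [ug g0]; split=> // x j Kx; apply: (g0 x j); rewrite (lt_trans _ Kx)// ltrDl.
suff H eps : 0 < eps -> `|integral_Rn (pderiv i f)| <= C * eps.
  apply/eqP; rewrite -normr_le0 leNgt; apply/negP => I0.
  have := H (`|integral_Rn (pderiv i f)| / 2 / C) ltac:(by rewrite !divr_gt0).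
  by rewrite mulrCA divff ?mulr1 ?gt_eqF//; lra.
move=> eps0; have [d d0 dP] := tdf.1 eps eps0.
pose s := Num.min d 1.
have s0 : 0 < s by rewrite lt_min d0 ltr01.
have sd : s <= d by rewrite ge_min lexx.
have s1 : s <= 1 by rewrite ge_min lexx orbT.
pose e : 'rV[R]_n := delta_mx 0 i.
have ne j : `|e 0 j| <= 1.
  by rewrite mxE eqxx /=; case: eqP => _; rewrite ?normr0 ?normr1.
have eE (y : 'rV[R]_n) r j : (y + r *: e) 0 j = y 0 j + r * e 0 j.
  by rewrite mxE [X in _ + X]mxE.
have tsh : tame (K + 1) (fun x => f (x + s *: e)).
  split.
    move=> eps' /tf.1[d' d'0 d'P]; exists d' => // x y xy; apply: d'P => j.
    by rewrite !eE opprD addrACA subrr addr0.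
  move=> x j Kx; apply: (tf.2 _ j); rewrite eE.
  have : `|s * e 0 j| <= 1.
    by rewrite normrM gtr0_norm//; apply: mulr_ile1 => //; exact: ltW.
  have := ler_normB (x 0 j + s * e 0 j) (s * e 0 j); rewrite addrK; lra.
have tdf' := tameS _ tdf; have tf' := tameS _ tf.
have := integral_Rn_lin (- s) K1 tdf' (tame_lin (-1) tf' tsh).
rewrite (integral_Rn_lin _ K1 tf' tsh) (integral_Rn_shift s i K0 tf) mulN1r addNr addr0 => E.
have : `|integral_Rn (fun x => - s * pderiv i f x + (-1 * f x + f (x + s *: e)))| <=
    s * ((2 * (K + 1)) ^+ n * eps).
  rewrite [leRHS]mulrCA; apply: tame_bound K1 (tame_lin _ tdf' (tame_lin _ tf' tsh)) _ => x.
  have [r /andP[r0 rs] fE] := pderiv_MVT x s0 df.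
  rewrite mulN1r (addrC (- f x)) fE mulNr addrC -mulrBr normrM gtr0_norm//.
  rewrite ler_pM2l//; apply/ltW/dP => j.
  rewrite eE addrC addKr normrM gtr0_norm//.
  by apply: le_lt_trans (lt_le_trans rs sd); rewrite ler_piMr// ltW.
rewrite E normrM normrN (gtr0_norm s0) ler_pM2l// => /le_trans; apply.
by rewrite ler_pM2r// lerDl.
Qed.

End integral_Rn_theory.

(** * Trace and Poisson bracket *)

Lemma is_integral0 (R : realType) n (M : manifold R n) (e : covariant M n) z :
  is_integral e (fun=> 0) z -> z = 0.
Proof.
move=> [m [c [rho [_ _ _ _ ->]]]]; rewrite big1// => i _.
have -> : (fun p => (rho i p)%:C * 0) = (fun=> 0 : R[i]) by apply/funext => p; rewrite mulr0.
rewrite /chart_integral (_ : patch _ _ _ = fun=> 0) ?integral_Rn0//.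
by apply/funext => x; rewrite patchE mul0r; case: ifP.
Qed.

Section deformation_theory.
Context {R : realType} {n : nat} {M : manifold R n} (D : deformation M).
Implicit Types (a b : alg D) (f g h : M -> R[i]).

Lemma redk0 p : redk (0 : alg D) p = 0.
Proof.
have := redk_linear 1 (0 : alg D) 0 p; rewrite scaler0 addr0 mul1r => /eqP.
by rewrite -subr_eq0 opprD addNKr oppr_eq0 => /eqP.
Qed.

Lemma redkZ z a p : redk (scal D z *: a) p = z * redk a p.
Proof. by have := redk_linear z a 0 p; rewrite addr0 redk0 addr0. Qed.

Lemma redkB a b p : redk (a - b) p = redk a p - redk b p.
Proof.
have := redk_linear (-1) b a p.
by rewrite rmorphN rmorph1 scaleN1r mulN1r addrC => ->; rewrite addrC.
Qed.

(** Inserting the hypothesis into itself gives [kap = kap ^+ 3 * s ^+ 2], so [kap] times any basis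
    element vanishes modulo [kap ^+ 3], against independence. With an empty basis every [a] lies in
    [kap ^+ 3] times [alg], hence is 0 modulo [kap]. *)
Lemma redk_trivial (s : base D) a : kap D = kap D ^+ 2 * s -> forall p, redk a p = 0.
Proof.
move=> ks; apply/redk_kernel.
have [B [e [gen free]]] := defo_free D.
have B0 (i : B) : False.
  (* The coefficients of the element [kap] of C[kap]/kap^3. *)
  pose x (_ : B) (r : 'I_3) : R[i] := if val r == 1%N then 1 else 0.
  have : x i (inord 1) = 0.
    apply: (free [:: i] x) => //; last by rewrite mem_head.
    exists (s ^+ 2 *: e i); rewrite subr0 big_seq1 scalerA; congr (_ *: _).
    rewrite !big_ord_recl big_ord0 /x /= rmorph0 rmorph1 !mul0r add0r !addr0 mul1r expr1.
    by rewrite {1}ks {1}[in LHS]expr2 {1}ks; ring.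
  by rewrite /x -[val _]/(nat_of_ord _) inordK//= => /eqP; rewrite oner_eq0.
have [[|i s'] [x [_ [d E]]]] := gen a; last by case: (B0 i).
exists (kap D ^+ 2 *: d); move: E; rewrite big_nil => ->.
by rewrite scalerA -exprS.
Qed.

Lemma integral_bracket (e : covariant M n) (tau : {linear alg D -> (base D)^o}) f g :
  is_trace tau ->
  (forall a z, is_integral e (redk a) z -> is_mod_kap D z (tau a)) ->
  Cc_smooth f -> Cc_smooth g ->
  exists2 h, is_poisson_bracket D f g h & forall z, is_integral e h z -> z = 0.
Proof.
move=> ttau itau /(redk_image D)[a <-] /(redk_image D)[b <-].
pose w := scal D 'i *: (amul a b - amul b a).
have [c] : congr_mod (kap D) w 0.
  apply/redk_kernel => p.
  by rewrite redkZ redkB !redk_mul (mulrC (redk a p)) subrr mulr0.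
rewrite subr0 => wc; exists (redk c).
  by exists a, b, c; split=> //; exists 0; rewrite -/w wc subrr scaler0.
move=> z hz; have [s ts] := itau _ _ hz.
have kt : kap D * tau c = 0.
  have : tau w = 0 by rewrite linearZ linearB /= ttau subrr scaler0.
  by rewrite wc linearZ.
(* If [z] were nonzero, [scal D z] would be invertible and [kap * (tau c - scal z) = kap ^+ 2 * s]
   could be solved for [kap], as [kap * tau c = 0]. Then [redk c] is zero, and so is its integral
   [z]. *)
have [//|z0] := eqVneq z 0.
apply: (is_integral0 (e := e)); rewrite (_ : (fun=> 0) = redk c)//.
apply/funext => p; rewrite (@redk_trivial (- s * scal D z^-1))//.
have : kap D * (tau c - scal D z) * scal D z^-1 = kap D * (kap D * s) * scal D z^-1.
  by rewrite ts.
rewrite mulrBr kt sub0r mulNr -mulrA -rmorphM divff// rmorph1 mulr1 => h.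
by rewrite -[LHS]opprK h; ring.
Qed.

End deformation_theory.

(** * Weakly divergence-free fields *)

Section test_functions.
Context {R : realType} {n : nat}.
Implicit Types (x y : 'rV[R]_n) (U : set 'rV[R]_n).

(** A polynomial in [y], hence smooth, unlike the sup norm that defines the topology of row
    vectors. *)
Definition sqdist x y : R := \sum_i (y 0 i - x 0 i) ^+ 2.

Lemma sqdistxx x : sqdist x x = 0.
Proof. by rewrite /sqdist big1// => i _; rewrite subrr expr0n. Qed.

Lemma sqdist_coord x y i : (y 0 i - x 0 i) ^+ 2 <= sqdist x y.
Proof.
by rewrite /sqdist (bigD1 i)//= lerDl sumr_ge0// => j _; exact: sqr_ge0.
Qed.

Lemma Ck_sqdist m k (W : set 'rV[R]_m) x (T : 'rV[R]_m -> 'rV[R]_n) : open W ->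
  (forall i, Ck k W (fun w => T w 0 i)) -> Ck k W (fun w => sqdist x (T w)).
Proof.
move=> oW CT; apply: Ck_sum => // i.
have C : Ck k W (fun w => T w 0 i - x 0 i) by apply: CkB => //; exact: Ck_cst.
exact: (CkM oW C C).
Qed.

Lemma Ck_sqdist_id k U x : open U -> Ck k U (sqdist x).
Proof. by move=> oU; apply: Ck_sqdist => // i; exact: Ck_coord. Qed.

Lemma sqdist_cts x : continuous (sqdist x).
Proof. by move=> y; apply: (Ck_cts (Ck_sqdist_id 0 x openT)). Qed.

Lemma open_sqdist_lt x r : open [set y | sqdist x y < r].
Proof.
by apply: (@open_comp _ _ (sqdist x) [set t | t < r]) => [y _|]; [exact: sqdist_cts|exact: open_lt].
Qed.

Lemma open_sqdist_gt x r : open [set y | r < sqdist x y].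
Proof.
by apply: (@open_comp _ _ (sqdist x) [set t | r < t]) => [y _|]; [exact: sqdist_cts|exact: open_gt].
Qed.

Lemma open_sqdist U x : open U -> U x ->
  exists2 r : R, 0 < r & forall y, sqdist x y < r -> U y.
Proof.
move=> oU Ux; have /nbhs_ballP[d /= d0 dU] : nbhs x U by exact: open_nbhs_nbhs.
exists (d ^+ 2); first by rewrite exprn_gt0.
move=> y xy; apply: dU; split => // i j.
rewrite !ord1 /ball/= distrC -(ltr_pXn2r (n := 2))// ?nnegrE ?ltW//.
by rewrite real_normK ?num_real//; apply: le_lt_trans (sqdist_coord x y j) xy.
Qed.

Lemma sqdist_box x r : 0 <= r ->
  exists2 K : R, 0 <= K & forall y i, K < `|y 0 i| -> r < sqdist x y.
Proof.
(* If a coordinate of [y] exceeds this bound, it differs from that of [x] by more than r + 1, whose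
   square is larger than r. *)
move=> r0; exists (\sum_i `|x 0 i| + (r + 1)).
  by rewrite addr_ge0 ?sumr_ge0// addr_ge0.
move=> y i Ky; apply: lt_le_trans (sqdist_coord x y i).
have : `|x 0 i| <= \sum_i `|x 0 i| by rewrite (bigD1 i)//= lerDl sumr_ge0.
have := ler_normD (y 0 i - x 0 i) (x 0 i); rewrite subrK => h1 h2.
rewrite -real_normK ?num_real//; have h3 : r + 1 < `|y 0 i - x 0 i| by lra.
by nra.
Qed.

Lemma compact_sqdist_le x r : 0 <= r -> compact [set y | sqdist x y <= r].
Proof.
move=> r0; have [K K0 KP] := sqdist_box x r0.
apply: (@subclosed_compact _ _ [set y : 'rV[R]_n | forall i, y 0 i \in `[- K, K]]).
- have -> : [set y | sqdist x y <= r] = ~` [set y | r < sqdist x y].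
    by apply/seteqP; split => y /=; rewrite leNgt => /negP.
  by apply: open_closedC; exact: open_sqdist_gt.
- apply: (@rV_compact _ _ (fun=> `[- K, K]%classic)) => _; exact: segment_compact.
- move=> y /= yr i; rewrite in_itv/= -ler_norml leNgt; apply/negP => /KP.
  by rewrite ltNge yr.
Qed.

(** Positive exactly on the open Euclidean ball of centre [x] and squared radius [r]. *)
Definition ball_bump x (r : R) y : R := flat 0 (r - sqdist x y).

Lemma Ck_bump m k (W : set 'rV[R]_m) x r (T : 'rV[R]_m -> 'rV[R]_n) : open W ->
  (forall i, Ck k W (fun w => T w 0 i)) -> Ck k W (fun w => ball_bump x r (T w)).
Proof.
move=> oW CT; apply: Ck_flat => //.
by apply: CkB => //; [exact: Ck_cst|exact: Ck_sqdist].
Qed.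

Lemma bump_out x r y : r <= sqdist x y -> ball_bump x r y = 0.
Proof. by move=> ry; rewrite /ball_bump flat_le0// subr_le0. Qed.

Lemma pderiv_bump_out x r y i : r < sqdist x y -> pderiv i (ball_bump x r) y = 0.
Proof.
move=> ry; rewrite (@pderiv_ext _ _ [set y | r < sqdist x y] _ (fun=> 0))//.
- by rewrite /pderiv derive_cst.
- exact: open_sqdist_gt.
- by move=> z /= /ltW; exact: bump_out.
Qed.

Lemma integral_Rn_sum (I : Type) (s : seq I) K (f : I -> 'rV[R]_n -> R) : 0 <= K ->
  (forall i, tame K (f i)) ->
  tame K (fun x => \sum_(i <- s) f i x) /\
  integral_Rn (fun x => \sum_(i <- s) f i x) = \sum_(i <- s) integral_Rn (f i).
Proof.
move=> K0 tf; elim: s => [|i s [IHt IH]].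
  rewrite (_ : (fun x => _) = fun=> 0); last by apply/funext => x; rewrite big_nil.
  by rewrite integral_Rn0 big_nil; split => //; exact: tame_cst0.
rewrite (_ : (fun x => _) = fun x => 1 * f i x + \sum_(i <- s) f i x); last first.
  by apply/funext => x; rewrite big_cons mul1r.
by split; [exact: tame_lin|rewrite (integral_Rn_lin _ K0 (tf i) IHt) IH big_cons mul1r].
Qed.

Lemma tame_sqdist K x r (f : 'rV[R]_n -> R) : (forall y i, K < `|y 0 i| -> r < sqdist x y) ->
  Ck 0 setT f -> (forall y, r < sqdist x y -> f y = 0) -> tame K f.
Proof.
move=> Kr Cf f0; apply: tame_cts => [y|y i /Kr/f0//].
exact: (Ck_cts Cf).
Qed.

(** By the Leibniz rule the integrand is the sum of the derivatives of bump times [q i], which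
    integrate to 0, minus bump times divergence. If the divergence were nonzero at [x], it would
    keep its sign on a small ball around [x], and a bump supported there would give a nonzero
    integral. *)
Lemma weak_divergence U x (r0 : R) (q : 'I_n -> 'rV[R]_n -> R) : open U -> 0 < r0 ->
  (forall y, sqdist x y < r0 -> U y) -> (forall i, Ck 1 U (q i)) ->
  (forall r : R, 0 < r -> r < r0 ->
     integral_Rn (patch (fun=> 0) U
       (fun y => \sum_i q i y * pderiv i (ball_bump x r) y)) = 0) ->
  \sum_i pderiv i (q i) x = 0.
Proof.
move=> oU r00 r0U Cq weak; pose d y := \sum_i pderiv i (q i) y.
rewrite -/(d x); apply/eqP/negPn/negP => dx0.
have dx : 0 < d x * d x by rewrite -expr2 exprn_even_gt0.
have Cd : Ck 0 U d by apply: Ck_sum => // i; exact: Ck_pderiv.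
have Ux : U x by apply: r0U; rewrite sqdistxx.
have [r1 r10 r1d] : exists2 r1 : R, 0 < r1 & forall y, sqdist x y < r1 -> 0 < d x * d y.
  have : \forall y \near x, 0 < d x * d y.
    have : {for x, continuous (fun y => d x * d y)}.
      by apply: continuousM; [exact: cst_continuous|exact: Ck_cts Cd Ux].
    by move=> /cvgrPdist_lt/(_ _ dx); apply: filterS => y;
      rewrite ltr_norml => /andP[_]; rewrite ltrBlDr ltrDl.
  rewrite /prop_near1 nbhsE => -[W [oW Wx] Wd]; have [r1 r10 r1W] := open_sqdist oW Wx.
  by exists r1 => // y /r1W/Wd.
(* Strictly below [r1], so that [d] has the sign of [d x] on the support of the bump, and strictly
   below [r0], so that [O1] and [O2] cover the whole space. *)
pose r := Num.min r0 r1 / 2.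
have m0 : 0 < Num.min r0 r1 by rewrite lt_min r00.
have m1 : Num.min r0 r1 <= r0 by rewrite ge_min lexx.
have m2 : Num.min r0 r1 <= r1 by rewrite ge_min lexx orbT.
have r_gt0 : 0 < r by rewrite divr_gt0.
have rr0 : r < r0 by rewrite /r; lra.
have rr1 : r < r1 by rewrite /r; lra.
have [K K0 KP] := sqdist_box x (ltW r_gt0).
pose O1 := [set y | sqdist x y < r0]; pose O2 := [set y | r < sqdist x y].
have oO1 : open O1 by exact: open_sqdist_lt.
have oO2 : open O2 by exact: open_sqdist_gt.
have O12 y : O1 y \/ O2 y.
  by rewrite /O1 /O2 /=; have [|h] := ltP (sqdist x y) r0; [left|right; exact: lt_le_trans h].
(* [f] is controlled only on [U]; the product with the bump is cut at [r0], beyond the support of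
   the bump, and so is as regular on the whole space as [f] is on [U]. *)
pose ex (f : 'rV[R]_n -> R) y := if sqdist x y < r0 then ball_bump x r y * f y else 0.
have exO1 f y : O1 y -> ball_bump x r y * f y = ex f y by rewrite /ex /O1 /= => ->.
have exO2 f y : O2 y -> 0 = ex f y.
  by rewrite /ex /O2 /= => /ltW/bump_out ->; rewrite mul0r if_same.
have Cbump k W : open W -> Ck k W (ball_bump x r).
  by move=> oW; apply: (@Ck_bump n k W x r id) => // i; exact: Ck_coord.
have Cex k f : Ck k U f -> Ck k setT (ex f).
  move=> Cf; apply: Ck_local => y _; have [yO1|yO2] := O12 y.
    exists O1; split=> //; apply: (Ck_ext oO1 (exO1 f)).
    by apply: CkM => //; [exact: Cbump|exact: Ck_sub Cf].
  exists O2; split=> //; apply: (Ck_ext oO2 (exO2 f)); exact: Ck_cst.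
have tex f : Ck 0 setT f -> (forall y, O2 y -> f y = 0) -> tame K f.
  exact: tame_sqdist.
have dex0 f i y : O2 y -> pderiv i (ex f) y = 0.
  move=> yO2; rewrite -(pderiv_ext _ oO2 yO2 (exO2 f)).
  by rewrite /pderiv derive_cst.
have tdex f i : Ck 1 U f -> tame K (pderiv i (ex f)).
  move=> Cf; apply: tex => [|y]; last exact: dex0.
  exact: Ck_pderiv (Cex _ _ Cf).
have td : tame K (ex d).
  by apply: tex => [|y yO2]; [exact: Cex|rewrite -exO2].
have Ed : \sum_i integral_Rn (pderiv i (ex (q i))) = 0.
  apply: big1 => i _; apply: (integral_Rn_pderiv K0).
  - apply: tex => [|y yO2]; last by rewrite -exO2.
    exact: Cex (Ck_pred (Cq i)).
  - by move=> y; apply: (Ck_derivable (k := 0) (U := setT)) => //; exact: Cex.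
  - exact: tdex.
have [ts Es] := integral_Rn_sum (index_enum 'I_n) K0 (fun i => tdex _ i (Cq i)).
have := weak r r_gt0 rr0.
rewrite (_ : patch _ _ _ = fun y => -1 * ex d y + \sum_i pderiv i (ex (q i)) y); last first.
  apply/funext => y; rewrite patchE; have [yO1|yO2] := O12 y.
    rewrite ifT ?inE; last exact: r0U.
    rewrite -exO1// mulN1r mulr_sumr addrC -sumrB; apply: eq_bigr => i _.
    rewrite -(pderiv_ext i oO1 yO1 (exO1 (q i))) /pderiv deriveM.
    - by rewrite /GRing.scale/= addrC addKr.
    - by apply: (Ck_derivable (k := 0) (U := setT)) => //; exact: Cbump openT.
    - by apply: (Ck_derivable (k := 0) (U := U)) => //; exact: r0U.
  rewrite -exO2// mulr0 add0r [RHS]big1 => [|i _]; last exact: dex0.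
  case: ifP => // _; apply: big1 => i _.
  by rewrite pderiv_bump_out// mulr0.
rewrite (integral_Rn_lin _ K0 td ts) Es Ed addr0 mulN1r => /eqP; rewrite oppr_eq0 => /eqP I0.
(* The factor [d x] makes the integrand nonnegative whatever the sign of the divergence. *)
have : 0 < integral_Rn (fun y => d x * ex d y + 0); last first.
  by rewrite (integral_Rn_lin _ K0 td (tame_cst0 _ _)) I0 integral_Rn0 mulr0 addr0 ltxx.
apply: (integral_Rn_gt0 (x := x) K0 (tame_lin _ td (tame_cst0 _ _))).
- move=> y; rewrite addr0 /ex; case: ifP => // _; last by rewrite mulr0.
  have [yr|/bump_out->] := ltP (sqdist x y) r; last by rewrite mul0r mulr0.
  by rewrite mulrCA mulr_ge0 ?flat_ge0// ltW// r1d// (lt_trans yr).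
- rewrite addr0 /ex sqdistxx r00 mulrCA mulr_gt0//.
  by rewrite flat_gt0// sqdistxx subr0.
Qed.

End test_functions.

(** * Test functions supported in a chart *)

Section chart_extension.
Context {R : realType} {n : nat} (M : manifold R n).
Implicit Types (c : charts M) (p : M) (F : set M) (k : 'rV[R]_n -> R).

Lemma range_param c x : range_of c x ->
  chart_dom c (chart_param c x) /\ chart_coord c (chart_param c x) = x.
Proof. by move=> [p cp <-]; rewrite chart_coordK. Qed.

Lemma range_coord c p : chart_dom c p -> range_of c (chart_coord c p).
Proof. by exists p. Qed.

Lemma open_param_preimage c (B : set M) : open B ->
  open [set x | range_of c x /\ B (chart_param c x)].
Proof.
move=> oB; rewrite openE => x [cx Bx]; apply: filterI.
  by apply: open_nbhs_nbhs; split => //; exact: chart_range_open.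
by apply: chart_param_cts => //; exact: open_nbhs_nbhs.
Qed.

Lemma overlapE c c' : chart_coord c @` (chart_dom c `&` chart_dom c') =
  [set x | range_of c x /\ chart_dom c' (chart_param c x)].
Proof.
apply/seteqP; split => [x [p [cp c'p] <-]|x [cx c'x]].
  by split; [exact: range_coord|rewrite chart_coordK].
have [cq E] := range_param cx; by exists (chart_param c x).
Qed.

Lemma compact_param c (K : set 'rV[R]_n) : compact K -> K `<=` range_of c ->
  compact (chart_param c @` K).
Proof.
move=> cK Kc; apply: continuous_compact => //.
by apply: continuous_in_subspaceT => x /set_mem/Kc; exact: chart_param_cts.
Qed.

Lemma pderiv_param_ext c i (f g : M -> R) F p : closed F -> chart_dom c p -> ~ F p ->
  (forall q, ~ F q -> f q = g q) ->
  pderiv i (fun x => f (chart_param c x)) (chart_coord c p) =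
  pderiv i (fun x => g (chart_param c x)) (chart_coord c p).
Proof.
move=> cF cp Fp fg; apply: (@pderiv_ext R n [set x | range_of c x /\ (~` F) (chart_param c x)]).
- exact: open_param_preimage (closed_openC cF).
- by split; [exact: range_coord|rewrite chart_coordK].
- by move=> x [_ /fg].
Qed.

Lemma partial_out c i (f : M -> R[i]) F p : closed F -> chart_dom c p -> ~ F p ->
  (forall q, ~ F q -> f q = 0) -> partial c i f p = 0.
Proof.
move=> cF cp Fp f0; rewrite /partial /pderivC.
rewrite (@pderiv_param_ext c i (fun q => complex.Re (f q)) (fun=> 0) F)//; last first.
  by move=> q /f0 ->.
rewrite (@pderiv_param_ext c i (fun q => complex.Im (f q)) (fun=> 0) F)//; last first.
  by move=> q /f0 ->.
by rewrite /pderiv derive_cst.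
Qed.

Definition ext_chart c k p : R :=
  if `[< chart_dom c p >] then k (chart_coord c p) else 0.

Lemma ext_chartE c k x : range_of c x -> ext_chart c k (chart_param c x) = k x.
Proof. by move=> /range_param[cp E]; rewrite /ext_chart E ifT//; exact/asboolP. Qed.

Lemma ext_chart_out c k (K : set 'rV[R]_n) p : (forall x, ~ K x -> k x = 0) ->
  ~ (chart_param c @` K) p -> ext_chart c k p = 0.
Proof.
move=> k0 Kp; rewrite /ext_chart; case: ifP => // /asboolP cp; apply: k0 => Kx.
by apply: Kp; exists (chart_coord c p) => //; rewrite chart_coordK.
Qed.

(* Composition of k with a smooth map is only asked for, so that no chain rule
   in several variables is needed. *)
Definition stably_smooth k := forall m (W : set 'rV[R]_m) (T : 'rV[R]_m -> 'rV[R]_n),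
  open W -> (forall i, smooth W (fun w => T w 0 i)) -> smooth W (fun w => k (T w)).

(** On the domain of [c] the function is [k] composed with a transition map; off the image of [K] it
    is 0. Both sets are open, the image being compact and thus closed in a Hausdorff space, and they
    cover [M]. *)
Lemma smooth_ext_chart c c' k (K : set 'rV[R]_n) : stably_smooth k -> compact K ->
  K `<=` range_of c -> (forall x, ~ K x -> k x = 0) ->
  smooth (range_of c') (fun x => ext_chart c k (chart_param c' x)).
Proof.
move=> sk cK Kc k0 m; apply: Ck_local => x c'x.
have clK : closed (chart_param c @` K).
  by apply: compact_closed (compact_param cK Kc); exact: manifold_hausdorff.
have [cx|cx] := pselect (chart_dom c (chart_param c' x)).
  have oN := open_param_preimage (c := c') (chart_dom_open c).
  exists [set x | range_of c' x /\ chart_dom c (chart_param c' x)]; split => //.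
  apply: (@Ck_ext _ _ _ _ (fun y => k (chart_coord c (chart_param c' y)))) => //.
    by move=> y [_ cy]; rewrite /ext_chart ifT//; exact/asboolP.
  apply: sk => // i; rewrite -overlapE; exact: charts_smooth.
have oN := open_param_preimage (c := c') (closed_openC clK).
exists [set y | range_of c' y /\ (~` (chart_param c @` K)) (chart_param c' y)]; split => //.
  split => // -[y Ky xy]; apply: cx; rewrite -xy.
  by have [] := range_param (Kc _ Ky).
apply: (@Ck_ext _ _ _ _ (fun=> 0)) => //; last exact: Ck_cst.
by move=> y [_ Ky]; rewrite (ext_chart_out k0).
Qed.

Lemma closed_support_ext_chart c k (K : set 'rV[R]_n) : compact K ->
  K `<=` range_of c -> (forall x, ~ K x -> k x = 0) ->
  closed_support 0 (ext_chart c k) `<=` chart_param c @` K.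
Proof.
move=> cK Kc k0.
have clK : closed (chart_param c @` K).
  by apply: compact_closed (compact_param cK Kc); exact: manifold_hausdorff.
rewrite /closed_support [X in _ `<=` X]((closure_id _).1 clK); apply: closure_subset => p /= kp.
by apply: contrapT => /(ext_chart_out k0) E; rewrite E eqxx in kp.
Qed.

Lemma Cc_smooth_ext_chart c k (K : set 'rV[R]_n) : stably_smooth k -> compact K ->
  K `<=` range_of c -> (forall x, ~ K x -> k x = 0) ->
  Cc_smooth (fun p => (ext_chart c k p)%:C).
Proof.
move=> sk cK Kc k0; split.
  move=> c'; split => m; first exact: (@smooth_ext_chart c c' k K sk cK Kc k0 m).
  by apply: Ck_cst; exact: chart_range_open.
apply: (@subclosed_compact _ _ (chart_param c @` K)).
- exact: closed_closure.
- exact: compact_param.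
- apply: subset_trans (closed_support_ext_chart cK Kc k0).
  apply: closure_subset => p /=; apply: contra_neq => ->.
  by [].
Qed.

Lemma partial_ext_chart c k i p : chart_dom c p ->
  partial c i (fun q => (ext_chart c k q)%:C) p = (pderiv i k (chart_coord c p))%:C.
Proof.
move=> cp; rewrite /partial /pderivC /=.
rewrite (@pderiv_ext _ _ (range_of c) (fun x => ext_chart c k (chart_param c x)) k).
- by rewrite /pderiv derive_cst.
- exact: chart_range_open.
- exact: range_coord.
- exact: ext_chartE.
Qed.

End chart_extension.

(** * Top-degree forms and the permutation symbol *)

Section top_forms.
Context {R : realType} {n : nat} {M : manifold R n}.
Implicit Types (c : charts M) (p : M) (I : {ffun 'I_n -> 'I_n}).

(** The sign of [I] if it is a permutation and 0 otherwise; as a determinant it inherits its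
    identities from row expansion and alternation. *)
Definition levi_civita I : R[i] := \det (\matrix_(l, m) (I l == m)%:R).

(** For injective [I] this is alternation. If [I] repeats a value, the transposition of the two
    places fixes [I] and changes the sign, so the component is 0. *)
Lemma form_top (e : covariant M n) c I p : is_form e -> chart_dom c p ->
  e c I p = levi_civita I * e c [ffun l => l] p.
Proof.
move=> [_ alt _] cp; rewrite /levi_civita.
have [injI|/injectivePn[l1 [l2 l12 Il]]] := boolP (injectiveb I).
  have /injectiveP iI := injI; pose s := perm iI.
  have -> : \matrix_(l, m) (I l == m)%:R = perm_mx s :> 'M[R[i]]_n.
    by apply/matrixP => l m; rewrite !mxE permE.
  rewrite det_perm -alt//; congr (e c _ p).
  by apply/ffunP => l; rewrite !ffunE permE.
rewrite (determinant_alternate l12) ?mul0r; last by move=> m; rewrite !mxE Il.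
have := alt c I (tperm l1 l2) p cp; rewrite odd_tperm l12 expr1 mulN1r.
have -> : [ffun l => I (tperm l1 l2 l)] = I.
  by apply/ffunP => l; rewrite ffunE; case: tpermP => [->|->|].
move=> /eqP; rewrite -subr_eq0 opprK -mulr2n mulrn_eq0 => /eqP; exact: contra_eq.
Qed.

End top_forms.

Section plateau.
Context {R : realType} {n : nat}.
Implicit Types (x y : 'rV[R]_n) (r a b : R).

Lemma stably_smooth_bump x r : stably_smooth (ball_bump x r).
Proof. by move=> m W T oW sT k; apply: Ck_bump => // i; exact: sT. Qed.

Definition plateau x a b y : R := cutoff a b (sqdist x y).

Lemma stably_smooth_plateau x a b : a < b -> stably_smooth (plateau x a b).
Proof.
by move=> ab m W T oW sT k; apply: Ck_cutoff => //; apply: Ck_sqdist => // i; exact: sT.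
Qed.

Lemma stably_smooth_coord i : stably_smooth (fun y : 'rV[R]_n => y 0 i).
Proof. by move=> m W T oW sT; exact: sT. Qed.

Lemma stably_smoothM (f g : 'rV[R]_n -> R) : stably_smooth f -> stably_smooth g ->
  stably_smooth (fun y => f y * g y).
Proof. by move=> sf sg m W T oW sT k; apply: CkM => //; [exact: sf|exact: sg]. Qed.

Lemma pderiv_plateau_coord x a b y i k : a < b -> sqdist x y < a ->
  pderiv i (fun y => plateau x a b y * y 0 k) y = (k == i)%:R.
Proof.
move=> ab ya.
rewrite (@pderiv_ext _ _ [set y | sqdist x y < a] _ (fun y => y 0 k))//.
- by have [_] := is_derive_coord k i y.
- exact: open_sqdist_lt.
- by move=> z /= /ltW za; rewrite /plateau cutoff1// mul1r.
Qed.

End plateau.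

(** * Vanishing divergence of the bivector density in a chart *)

Section chart_divergence.
Context {R : realType} {n : nat} {M : manifold R n}.
Variables (e : covariant M n) (D : deformation M) (P : bivector M).
Hypotheses (he : is_volume_form e) (hP : is_poisson_bivector D P).
Variable tau : {linear alg D -> (base D)^o}.
Hypotheses (ttau : is_trace tau)
  (itau : forall (a : alg D) (z : R[i]), is_integral e (redk a) z -> is_mod_kap D z (tau a)).
Implicit Types (c : charts M) (p : M).

(** [h] is the bracket of the bump and the coordinate [k] cut off by a plateau. The plateau serves
    twice: as this cutoff, and as the partition of unity that computes the integral of [h] in the
    single chart [c]. *)
Lemma chart_integral_bump c (x : 'rV[R]_n) (r0 r : R) k : 0 < r -> r < r0 ->
  (forall y, sqdist x y < r0 -> range_of c y) ->
  exists2 h : M -> R[i], chart_integral e c h = 0 &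
    forall y, range_of c y ->
      h (chart_param c y) = \sum_i P c i k (chart_param c y) * (pderiv i (ball_bump x r) y)%:C.
Proof.
(* In squared radii r < a < b < r0: the bump ends at [r], the plateau is 1 up to [a] and 0 from [b]
   on, and the closed ball of squared radius [b] lies in the chart. *)
move=> rgt0 rr0 r0c; pose a := r + (r0 - r) / 3; pose b := a + (r0 - r) / 3.
have ra : r < a by rewrite /a; lra.
have ab : a < b by rewrite /b; lra.
have br0 : b < r0 by rewrite /b /a; lra.
have b0 : 0 <= b by rewrite /b /a; lra.
pose phi := ball_bump x r; pose beta := plateau x a b.
pose g0 (y : 'rV[R]_n) := beta y * y 0 k.
pose Kr := [set y | sqdist x y <= r]; pose Kb := [set y | sqdist x y <= b].
have cKr : compact Kr by apply: compact_sqdist_le; exact: ltW.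
have cKb : compact Kb by exact: compact_sqdist_le.
have Krc : Kr `<=` range_of c by move=> y; rewrite /Kr /= => yr; apply: r0c; lra.
have Kbc : Kb `<=` range_of c by move=> y; rewrite /Kb /= => yb; apply: r0c; lra.
have phi0 y : ~ Kr y -> phi y = 0.
  by rewrite /Kr /= => /negP; rewrite -ltNge => /ltW; exact: bump_out.
have beta0 y : ~ Kb y -> beta y = 0.
  by rewrite /Kb /= => /negP; rewrite -ltNge => /ltW yb; rewrite /beta /plateau cutoff0.
have g00 y : ~ Kb y -> g0 y = 0 by move=> /beta0 E; rewrite /g0 E mul0r.
have sphi : stably_smooth phi by exact: stably_smooth_bump.
have sbeta : stably_smooth beta by exact: stably_smooth_plateau.
have sg0 : stably_smooth g0.
  by apply: stably_smoothM => //; exact: stably_smooth_coord.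
pose f p := (ext_chart c phi p)%:C; pose g p := (ext_chart c g0 p)%:C.
have [h fgh zh] := integral_bracket ttau itau
  (Cc_smooth_ext_chart sphi cKr Krc phi0) (Cc_smooth_ext_chart sg0 cKb Kbc g00).
have hE := hP.2 _ _ _ fgh.
pose F := chart_param c @` Kr.
have clF : closed F.
  by apply: compact_closed (compact_param cKr Krc); exact: manifold_hausdorff.
(* [h] is a function on all of [M], so the bracket formula is read in any chart around [q]; there
   [f] vanishes near [q] because [F] is closed. *)
have h0 q : ~ F q -> h q = 0.
  move=> Fq; have [c' c'q] := charts_cover q; rewrite (hE c' q c'q).
  apply: big1 => i _; apply: big1 => j _.
  rewrite (@partial_out _ _ _ c' i _ F q)// ?mulr0 ?mul0r//.
  by move=> q' Fq'; rewrite (ext_chart_out phi0 Fq').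
have rhoF q : F q -> ext_chart c beta q = 1.
  move=> [y + <-]; rewrite /Kr /= => yr; rewrite ext_chartE; last by apply: r0c; lra.
  by rewrite /beta /plateau cutoff1//; lra.
have rhoh : (fun p => (ext_chart c beta p)%:C * h p) = h.
  apply/funext => q; have [/rhoF->|/h0->] := pselect (F q); last by rewrite mulr0.
  by rewrite mul1r.
have hF : closed_support 0 h `<=` F.
  rewrite /closed_support [X in _ `<=` X]((closure_id _).1 clF).
  by apply: closure_subset => p /=; apply: contra_neqP => /h0.
exists h.
  (* One function suffices: the extended plateau is 1 on [F], which contains the support of [h]. *)
  apply: zh; exists 1%N, (fun=> c), (fun=> ext_chart c beta); split.
  - by move=> _ c' m; exact: (@smooth_ext_chart _ _ M c c' _ _ sbeta cKb Kbc beta0 m).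
  - move=> _ p; rewrite /ext_chart; case: ifP => // _; exact: cutoff_ge0.
  - move=> _; have S := closed_support_ext_chart cKb Kbc beta0; split.
      apply: subclosed_compact (compact_param cKb Kbc) S; exact: closed_closure.
    by apply: subset_trans S _ => _ [y Ky <-]; have [] := range_param (Kbc _ Ky).
  - move=> p hp; rewrite big_ord1; apply: rhoF; exact: hF.
  - by rewrite big_ord1 rhoh.
move=> y cy; have [cpy Ey] := range_param cy.
rewrite (hE c _ cpy); apply: eq_bigr => i _.
under eq_bigr do rewrite !partial_ext_chart// Ey.
(* Outside the ball both sides contain derivatives of the bump and vanish; inside, the plateau is
   locally 1, so the j-th derivative of [g0] is the Kronecker symbol of j and k. *)
have [ry|yr] := ltP r (sqdist x y).
  rewrite pderiv_bump_out// mulr0 big1// => j _.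
  by rewrite mulr0 mul0r.
rewrite (bigD1 k)//= big1 ?addr0 => [|j jk].
  by rewrite pderiv_plateau_coord// ?eqxx ?mulr1//; lra.
by rewrite pderiv_plateau_coord// 1?eq_sym ?(negPf jk) ?mulr0//; lra.
Qed.

Local Notation top := [ffun l : 'I_n => l].

Lemma complex_sum (I : Type) (s : seq I) (a b : I -> R) :
  \sum_(i <- s) (a i +i* b i) = (\sum_(i <- s) a i) +i* (\sum_(i <- s) b i).
Proof.
elim: s => [|i s IH]; first by rewrite !big_nil.
by rewrite !big_cons IH.
Qed.

Lemma volume_neq0 c p : chart_dom c p -> complex.Re (e c top p) != 0.
Proof.
move=> cp; have [fe im0 ne0] := he; have [I] := ne0 c p cp.
rewrite (form_top I fe cp) mulf_eq0 negb_or => /andP[_].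
by rewrite eq_complex im0// eqxx andbT.
Qed.

Lemma divergence_component (A : R[i] -> R) c p k :
  A 0 = 0 -> (forall y z, A (y + z) = A y + A z) ->
  (forall z (t : R), A (z * t%:C) = A z * t) ->
  (forall i, smooth (range_of c) (fun x => A (P c i k (chart_param c x)))) ->
  (forall f, chart_integral e c f = 0 ->
     integral_Rn (patch (fun=> 0) (range_of c) (fun x => A (f (chart_param c x)) *
       `|complex.Re (e c top (chart_param c x))|)) = 0) ->
  chart_dom c p ->
  \sum_i pderiv i (fun x => A (P c i k (chart_param c x)) *
    complex.Re (e c top (chart_param c x))) (chart_coord c p) = 0.
Proof.
move=> A0 AD AM sA iA cp; pose V := range_of c; pose x0 := chart_coord c p.
pose E x := complex.Re (e c top (chart_param c x)).
have oV : open V by exact: chart_range_open.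
have Vx0 : V x0 by exact: range_coord.
have sE : smooth V E by have [[+ _ _] _ _] := he => /(_ c top)[].
have E0 : E x0 != 0 by rewrite /E /x0 chart_coordK//; exact: volume_neq0.
have [r0 r00 r0P] : exists2 r0 : R, 0 < r0 & forall y, sqdist x0 y < r0 -> V y /\ 0 < E x0 * E y.
  have : \forall y \near x0, V y /\ 0 < E x0 * E y.
    apply: filterI; first exact: open_nbhs_nbhs.
    have : {for x0, continuous (fun y => E x0 * E y)}.
      by apply: continuousM; [exact: cst_continuous|exact: Ck_cts (sE 0) Vx0].
    have EE : 0 < E x0 * E x0 by rewrite -expr2 exprn_even_gt0.
    by move=> /cvgrPdist_lt/(_ _ EE); apply: filterS => y;
      rewrite ltr_norml => /andP[_]; rewrite ltrBlDr ltrDl.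
  rewrite /prop_near1 nbhsE => -[W [oW Wx] Wd]; have [r1 r10 r1W] := open_sqdist oW Wx.
  by exists r1 => // y /r1W/Wd.
(* On the ball the density keeps its sign at [x0], so its absolute value is [s] times the density;
   the constant [s] cancels at the end. *)
pose s := Num.sg (E x0).
have sE' y : sqdist x0 y < r0 -> `|E y| = s * E y.
  move=> /r0P[_ EE]; rewrite /s; move: (E y) EE => Ey; have [p0|n0|z0] := ltgtP 0 (E x0).
  - by rewrite pmulr_rgt0// => y0; rewrite gtr0_sg// mul1r gtr0_norm.
  - by rewrite nmulr_rgt0// => y0; rewrite ltr0_sg// mulN1r ltr0_norm.
  - by rewrite -z0 mul0r ltxx.
have s0 : s != 0 by rewrite sgr_eq0.
pose q i y := s * (A (P c i k (chart_param c y)) * E y).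
have Cq i : Ck 1 V (fun y => A (P c i k (chart_param c y)) * E y).
  by apply: CkM => //; exact: sA.
have Csq i : Ck 1 V (q i) by apply: CkM => //; exact: Ck_cst.
apply: (mulfI s0); rewrite mulr0 mulr_sumr.
rewrite -[RHS](@weak_divergence _ _ V x0 r0 q oV r00 (fun y h => (r0P y h).1) Csq).
  apply: eq_bigr => i _; rewrite /pderiv /q.
  by rewrite -[LHS]/(s *: _) -deriveZ//; apply: (Ck_derivable (k := 0) (U := V)) => //.
move=> r rgt0 rr0.
have [h /iA hI hE] := chart_integral_bump k rgt0 rr0 (fun y h => (r0P y h).1).
rewrite -[RHS]hI; congr integral_Rn; apply/funext => y; rewrite !patchE.
case: ifPn => // /set_mem Vy; rewrite hE// -/(E y).
rewrite (big_morph A AD A0) mulr_suml; apply: eq_bigr => i _; rewrite AM.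
have [ry|yr] := ltP r (sqdist x0 y).
  by rewrite pderiv_bump_out// !(mulr0, mul0r).
by rewrite sE' ?(le_lt_trans yr)// /q; ring.
Qed.

Lemma chart_divergence c p k : chart_dom c p ->
  \sum_i partial c i (fun q => P c i k q * e c top q) p = 0.
Proof.
move=> cp; have [[sP _ _] _] := hP; have [_ im0 _] := he.
rewrite /partial /pderivC complex_sum.
have DRe : \sum_i pderiv i (fun x => complex.Re (P c i k (chart_param c x)) *
    complex.Re (e c top (chart_param c x))) (chart_coord c p) = 0.
  apply: divergence_component => //.
  - by move=> [? ?] [? ?].
  - by move=> [? ?] t /=; rewrite mulr0 subr0.
  - by move=> i; have [] := sP c i k.
  - by move=> f [].
have DIm : \sum_i pderiv i (fun x => complex.Im (P c i k (chart_param c x)) *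
    complex.Re (e c top (chart_param c x))) (chart_coord c p) = 0.
  apply: divergence_component => //.
  - by move=> [? ?] [? ?].
  - by move=> [? ?] t /=; rewrite mulr0 add0r.
  - by move=> i; have [] := sP c i k.
  - by move=> f [].
(* As the density is real, taking real or imaginary parts of the product affects only the factor
   [P]. *)
have rangeE x : range_of c x -> complex.Im (e c top (chart_param c x)) = 0.
  by move=> /range_param[? _]; exact: im0.
rewrite -[RHS]/(0 +i* 0); congr (_ +i* _); [rewrite -[RHS]DRe|rewrite -[RHS]DIm];
  apply: eq_bigr => i _;
  apply: (@pderiv_ext _ _ (range_of c)).
1,4: exact: chart_range_open.
1,3: exact: range_coord.
all: move=> x /rangeE; case: (e c top _) => a b /= ->; case: (P c i k _) => u v /=.
  by rewrite mulr0 subr0.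
by rewrite mulr0 add0r.
Qed.

End chart_divergence.

(** * Exterior derivative and covariant divergence *)

Section partial_calculus.
Context {R : realType} {n : nat} {M : manifold R n}.
Implicit Types (c : charts M) (p : M) (f g : M -> R[i]).

Lemma partial_ext c i f g p : chart_dom c p ->
  (forall q, chart_dom c q -> f q = g q) -> partial c i f p = partial c i g p.
Proof.
move=> cp fg; rewrite /partial /pderivC; congr (_ +i* _);
  apply: (@pderiv_ext _ _ (range_of c)).
1,4: exact: chart_range_open.
1,3: exact: range_coord.
all: by move=> x /range_param[cx _]; rewrite fg.
Qed.

Lemma smooth_inD c f g : smooth_in c f -> smooth_in c g ->
  smooth_in c (fun q => f q + g q).
Proof.
have oV : open (range_of c) by exact: chart_range_open.
move=> [f1 f2] [g1 g2]; split=> k.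
  apply: (Ck_ext oV _ (CkD oV (f1 k) (g1 k))) => x _.
  by case: (f _) => ? ?; case: (g _).
apply: (Ck_ext oV _ (CkD oV (f2 k) (g2 k))) => x _.
by case: (f _) => ? ?; case: (g _).
Qed.

Lemma smooth_inM c f g : smooth_in c f -> smooth_in c g ->
  smooth_in c (fun q => f q * g q).
Proof.
have oV : open (range_of c) by exact: chart_range_open.
move=> [f1 f2] [g1 g2]; split=> k.
  apply: (Ck_ext oV _ (CkB oV (CkM oV (f1 k) (g1 k)) (CkM oV (f2 k) (g2 k)))) => x _.
  by case: (f _) => ? ?; case: (g _).
apply: (Ck_ext oV _ (CkD oV (CkM oV (f1 k) (g2 k)) (CkM oV (f2 k) (g1 k)))) => x _.
by case: (f _) => ? ?; case: (g _).
Qed.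

Lemma smooth_in_cst c z : smooth_in c (fun=> z).
Proof. by split=> k; apply: Ck_cst; exact: chart_range_open. Qed.

Lemma partial_cst c i z p : partial c i (fun=> z) p = 0.
Proof. by rewrite /partial /pderivC /pderiv !derive_cst. Qed.

Lemma partialD c i f g p : chart_dom c p -> smooth_in c f -> smooth_in c g ->
  partial c i (fun q => f q + g q) p = partial c i f p + partial c i g p.
Proof.
move=> cp [f1 f2] [g1 g2]; have Vp := range_coord cp.
have dd (u : 'rV[R]_n -> R) : smooth (range_of c) u ->
    derivable u (chart_coord c p) (delta_mx 0 i).
  by move=> su; apply: (Ck_derivable (k := 0) (U := range_of c)) => //; exact: (su 1%N).
have part (A : R[i] -> R) (AD : forall y z, A (y + z) = A y + A z) :
    (fun x => A (f (chart_param c x) + g (chart_param c x))) =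
    (fun x => A (f (chart_param c x))) + (fun x => A (g (chart_param c x))).
  by apply/funext => x; rewrite AD.
rewrite /partial /pderivC /pderiv !part; try by move=> [? ?] [? ?].
by rewrite (deriveD (dd _ f1) (dd _ g1)) (deriveD (dd _ f2) (dd _ g2)).
Qed.

Lemma partialM c i f g p : chart_dom c p -> smooth_in c f -> smooth_in c g ->
  partial c i (fun q => f q * g q) p = partial c i f p * g p + f p * partial c i g p.
Proof.
move=> cp [f1 f2] [g1 g2]; have Vp := range_coord cp.
have dd (u : 'rV[R]_n -> R) : smooth (range_of c) u ->
    derivable u (chart_coord c p) (delta_mx 0 i).
  by move=> su; apply: (Ck_derivable (k := 0) (U := range_of c)) => //; exact: (su 1%N).
have [df1 df2 dg1 dg2] := And4 (dd _ f1) (dd _ f2) (dd _ g1) (dd _ g2).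
have ReE : (fun x => complex.Re (f (chart_param c x) * g (chart_param c x))) =
    (fun x => complex.Re (f (chart_param c x))) * (fun x => complex.Re (g (chart_param c x))) -
    (fun x => complex.Im (f (chart_param c x))) * (fun x => complex.Im (g (chart_param c x))).
  by apply/funext => x; rewrite -[RHS]/(_ * _ - _ * _ : R) /=; case: (f _) => ? ?; case: (g _).
have ImE : (fun x => complex.Im (f (chart_param c x) * g (chart_param c x))) =
    (fun x => complex.Re (f (chart_param c x))) * (fun x => complex.Im (g (chart_param c x))) +
    (fun x => complex.Im (f (chart_param c x))) * (fun x => complex.Re (g (chart_param c x))).
  by apply/funext => x; rewrite -[RHS]/(_ * _ + _ * _ : R) /=; case: (f _) => ? ?; case: (g _).
rewrite /partial /pderivC /pderiv ReE ImE.
rewrite (deriveB (derivableM df1 dg1) (derivableM df2 dg2)).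
rewrite (deriveD (derivableM df1 dg2) (derivableM df2 dg1)).
rewrite (deriveM df1 dg1) (deriveM df2 dg2) (deriveM df1 dg2) (deriveM df2 dg1).
rewrite /GRing.scale/= chart_coordK//.
move: ('D__ _ _) ('D__ _ _) ('D__ _ _) ('D__ _ _) => a b u v.
case: (f p) (g p) => [x y] [z w]; apply/eqP; rewrite eq_complex /=.
by apply/andP; split; apply/eqP; ring.
Qed.

Lemma partialZ c i z f p : chart_dom c p -> smooth_in c f ->
  partial c i (fun q => z * f q) p = z * partial c i f p.
Proof.
move=> cp sf; rewrite partialM//; last exact: smooth_in_cst.
by rewrite partial_cst mul0r add0r.
Qed.

Lemma partial_sum (J : Type) (s : seq J) (f : J -> M -> R[i]) c i p : chart_dom c p ->
  (forall j, smooth_in c (f j)) ->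
  smooth_in c (fun q => \sum_(j <- s) f j q) /\
  partial c i (fun q => \sum_(j <- s) f j q) p = \sum_(j <- s) partial c i (f j) p.
Proof.
move=> cp sf; elim: s => [|j s [IHs IH]].
  rewrite (_ : (fun q => _) = fun=> 0); last by apply/funext => q; rewrite big_nil.
  by rewrite partial_cst big_nil; split => //; exact: smooth_in_cst.
rewrite (_ : (fun q => _) = fun q => f j q + \sum_(j <- s) f j q); last first.
  by apply/funext => q; rewrite big_cons.
by split; [exact: smooth_inD|rewrite partialD// big_cons IH].
Qed.

End partial_calculus.

Section levi_civita_identities.
Context {R : realType} {n : nat}.

Lemma icons_lift0 k (a : 'I_n) (L : {ffun 'I_k -> 'I_n}) :
  [ffun l => icons a L (lift ord0 l)] = L.
Proof. by apply/ffunP => l; rewrite !ffunE liftK. Qed.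

Lemma icons_liftS k (a : 'I_n) (L : {ffun 'I_k.+1 -> 'I_n}) r :
  [ffun l => icons a L (lift (lift ord0 r) l)] = icons a [ffun l => L (lift r l)].
Proof.
apply/ffunP => l; rewrite ffunE; case: (unliftP ord0 l) => [l' ->|->].
  have -> : lift (lift ord0 r) (lift ord0 l') = lift ord0 (lift r l').
    by apply/val_inj; rewrite /= /fintype.bump/= !add1n ltnS; case: leqP.
  by rewrite !ffunE !liftK ffunE.
have -> : lift (lift ord0 r) (ord0 : 'I_k.+1) = ord0 by apply/val_inj.
by rewrite !ffunE !unlift_none.
Qed.

(* Expansion along the first row of a determinant with two equal rows. *)
Lemma levi_civita_expand (L : {ffun 'I_n.+1 -> 'I_n}) m :
  \sum_(r < n.+1) (-1) ^+ r * (L r == m)%:R * levi_civita [ffun l => L (lift r l)] = 0 :> R[i].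
Proof.
pose Y : 'M[R[i]]_n.+1 := \matrix_(s < n.+1, r < n.+1) (L r == odflt m (unlift ord0 s))%:R.
have : \det Y = 0.
  apply: (@determinant_alternate _ _ _ ord0 (lift ord0 m)) => // r.
  by rewrite !mxE unlift_none liftK.
rewrite (expand_det_row _ ord0) => Y0; rewrite -[RHS]Y0; apply: eq_bigr => r _.
rewrite /cofactor mxE unlift_none /= mulrCA mulrA; congr (_ * _).
rewrite /levi_civita -det_tr; congr (\det _); apply/matrixP => s l.
by rewrite !mxE ffunE liftK.
Qed.

End levi_civita_identities.

(** In the expansion for the list a, b, I, the terms that remove [a] and [b] are moved to the right;
    the others have sign (-1)^(j+2) = (-1)^j. The left side is the [I]-component of dx^m wedge the
    contraction of the symbol with the a-th and b-th coordinate vectors. *)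
Lemma levi_civita_exterior (R : realType) n (I : {ffun 'I_n.+1 -> 'I_n.+2}) a b m :
  \sum_(j < n.+1) (-1) ^+ j * (I j == m)%:R *
    levi_civita (icons a (icons b [ffun l => I (lift j l)])) =
  (b == m)%:R * levi_civita (icons a I) - (a == m)%:R * levi_civita (icons b I) :> R[i].
Proof.
have := @levi_civita_expand R _ (icons a (icons b I)) m.
rewrite 2!big_ord_recl icons_lift0 icons_liftS icons_lift0.
have i0 k (d : 'I_n.+2) (L : {ffun 'I_k -> 'I_n.+2}) : icons d L ord0 = d.
  by rewrite ffunE unlift_none.
have iS k (d : 'I_n.+2) (L : {ffun 'I_k -> 'I_n.+2}) j : icons d L (lift ord0 j) = L j.
  by rewrite ffunE liftK.
rewrite i0 iS i0.
under [X in _ + (_ + X)]eq_bigr => j _.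
  rewrite !iS !icons_liftS /= /fintype.bump/= !add1n !exprS !mulN1r opprK.
  over.
rewrite /= /fintype.bump/= expr0 mul1r addn0 expr1 mulN1r mulNr => /eqP.
by rewrite addrA [X in X == 0]addrC addr_eq0 opprD opprK addrC => /eqP.
Qed.

Section conclusions.
Context {R : realType} {n : nat} {M : manifold R n}.
Variables (e : covariant M n) (P : bivector M).
Hypotheses (he : is_volume_form e) (hP : is_bivector P).
Local Notation top := [ffun l : 'I_n => l].
Hypothesis div : forall (c : charts M) p k, chart_dom c p ->
  \sum_i partial c i (fun q => P c i k q * e c top q) p = 0.

Lemma smooth_density c i k : smooth_in c (fun q => P c i k q * e c top q).
Proof. by have [[? _ _] _ _] := he; have [? _ _] := hP; exact: smooth_inM. Qed.

Lemma div_right c p k : chart_dom c p ->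
  \sum_i partial c i (fun q => P c k i q * e c top q) p = 0.
Proof.
move=> cp; have [_ alt _] := hP; rewrite -[RHS]oppr0 -[X in _ = - X](div k cp) -sumrN.
apply: eq_bigr => i _; rewrite -mulN1r -partialZ//; last exact: smooth_density.
by apply: partial_ext => // q cq; rewrite mulN1r -mulNr -alt.
Qed.

(** A parallel volume form has d_j E = Gamma^l_{lj} E for its top component E. Multiplied by E, the
    trace term of the covariant divergence therefore completes the Leibniz rule for d_j (P^{ij} E),
    and the other Christoffel term vanishes by symmetry. *)
Lemma connection_divergence (G : christoffel M) c i p : torsion_free G ->
  (forall c j I p, chart_dom c p -> nabla_form G e c j I p = 0) ->
  chart_dom c p -> \sum_j nabla_bivector G P c j i j p = 0.
Proof.
move=> tG nG cp; have [fe im0 ne0] := he; have [sP alt _] := hP; have [se _ _] := fe.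
have E0 : e c top p != 0.
  have [I] := ne0 c p cp; rewrite (form_top I fe cp) mulf_eq0 negb_or => /andP[_].
  exact.
have dE j : partial c j (e c top) p = (\sum_l G c l l j p) * e c top p.
  have /eqP := nG c j top p cp; rewrite /nabla_form subr_eq0 => /eqP ->.
  rewrite mulr_suml; apply: eq_bigr => l _; rewrite (bigD1 l)//= big1 ?addr0.
    rewrite ffunE (tG c l l j p cp); congr (_ * e c _ p).
    by apply/ffunP => l'; rewrite !ffunE; case: eqP.
  (* For m different from l the modified tuple takes the value m at both places l and m. *)
  move=> m ml; rewrite (form_top _ fe cp) /levi_civita.
  rewrite (@determinant_alternate _ _ _ l m) ?mul0r ?mulr0// 1?eq_sym// => s.
  by rewrite !mxE !ffunE eqxx (negPf ml).
(* Symmetric lower indices contracted with the antisymmetric [P]: exchanging the summation indices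
   shows that the sum is its own opposite. *)
have X0 : \sum_j \sum_m G c i j m p * P c m j p = 0.
  have : \sum_j \sum_m G c i j m p * P c m j p = - \sum_j \sum_m G c i j m p * P c m j p.
    rewrite {1}exchange_big -sumrN; apply: eq_bigr => j _; rewrite -sumrN.
    by apply: eq_bigr => m _; rewrite tG// (alt c m j)// mulrN.
  by move=> /eqP; rewrite -addr_eq0 -mulr2n mulrn_eq0 => /eqP.
rewrite /nabla_bivector !big_split /= X0 addr0.
apply: (mulIf E0); rewrite mul0r -[RHS](div_right i cp).
rewrite mulrDl exchange_big /= !mulr_suml -big_split; apply: eq_bigr => j _ /=.
rewrite partialM// dE; congr (_ + _).
by rewrite -mulr_suml mulrAC mulrC mulrA.
Qed.

End conclusions.

(** The symbol is constant, so derivatives fall only on P^{ab} E. The exterior identity then forces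
    the derivative index to be a or b, which leaves two divergences of P E, one for each index of
    [P]. *)
Lemma ext_d_contract (R : realType) n (M : manifold R n) (e : covariant M n)
    (P : bivector M) (he : is_volume_form e) (hP : is_bivector P)
    (div : forall (c : charts M) p k, chart_dom c p ->
      \sum_i partial c i (fun q => P c i k q * e c [ffun l => l] q) p = 0)
    (c : charts M) I p : chart_dom c p -> ext_d (contract_form P e) c I p = 0.
Proof.
case: n M e P he hP div c I p => [|[|n]] M e P he hP div c I p cp.
(* In dimensions 0 and 1 the contraction is the constant 0 by definition. *)
1,2: by apply: big1 => j _; rewrite [X in _ * X]partial_cst mulr0.
pose q a b r := P c a b r * e c [ffun l => l] r.
have sq a b : smooth_in c (q a b) by exact: smooth_density.
have [fe _ _] := he.
have wE J m : partial c m (contract_form P e c J) p = 2^-1 * \sum_a \sum_b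
    levi_civita (icons a (icons b J)) * partial c m (q a b) p.
  pose F (ab : 'I_n.+2 * 'I_n.+2) r := levi_civita (icons ab.1 (icons ab.2 J)) * q ab.1 ab.2 r.
  have sF ab : smooth_in c (F ab) by apply: smooth_inM => //; exact: smooth_in_cst.
  have [sS dS] := partial_sum (index_enum ('I_n.+2 * 'I_n.+2)%type) m cp sF.
  transitivity (partial c m (fun r => 2^-1 * \sum_ab F ab r) p).
    apply: partial_ext => // r cr; rewrite /= pair_big /=; congr (_ * _).
    by apply: eq_bigr => ab _; rewrite (form_top _ fe cr) /F /q mulrCA.
  rewrite partialZ// dS pair_big /=; congr (_ * _); apply: eq_bigr => ab _.
  by rewrite partialZ.
rewrite /ext_d.
(* The derivative index [I j] is replaced by a free index m with a Kronecker symbol, to bring the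
   sum over j into the form of [levi_civita_exterior]. *)
transitivity (2^-1 * \sum_a \sum_b \sum_m partial c m (q a b) p *
    ((b == m)%:R * levi_civita (icons a I) - (a == m)%:R * levi_civita (icons b I))).
  under eq_bigr do rewrite wE mulrCA mulr_sumr.
  rewrite -mulr_sumr; congr (_ * _); rewrite exchange_big; apply: eq_bigr => a _ /=.
  under eq_bigr do rewrite mulr_sumr.
  rewrite exchange_big; apply: eq_bigr => b _ /=.
  under [RHS]eq_bigr do rewrite -levi_civita_exterior mulr_sumr.
  rewrite exchange_big; apply: eq_bigr => j _ /=.
  rewrite (bigD1 (I j))//= big1 ?addr0 => [|m mI]; last first.
    by rewrite eq_sym (negPf mI) mulr0 mul0r mulr0.
  by rewrite eqxx mulr1 [LHS]mulrA [LHS]mulrC.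
apply/eqP; rewrite mulf_eq0; apply/orP; right; apply/eqP.
transitivity (\sum_a levi_civita (icons a I) * (\sum_b partial c b (q a b) p) -
    \sum_b levi_civita (icons b I) * (\sum_a partial c a (q a b) p)).
  under [X in _ - X]eq_bigr do rewrite mulr_sumr.
  rewrite [X in _ - X]exchange_big -sumrB; apply: eq_bigr => a _ /=.
  rewrite mulr_sumr -sumrB; apply: eq_bigr => b _.
  under eq_bigr do rewrite mulrBr.
  rewrite sumrB (bigD1 b)//= eqxx mul1r big1 ?addr0 => [|m mb]; last first.
    by rewrite eq_sym (negPf mb) mul0r mulr0.
  rewrite [X in _ - X](bigD1 a)//= eqxx mul1r big1 ?addr0 => [|m ma]; last first.
    by rewrite eq_sym (negPf ma) mul0r mulr0.
  by congr (_ - _); rewrite mulrC.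
rewrite !big1 ?subrr// => a _; first by rewrite div// mulr0.
by rewrite (div_right he hP div)// mulr0.
Qed.

Theorem theorem1 (R : realType) (n : nat) (M : manifold R n)
    (e : covariant M n) (he : is_volume_form e)
    (D : deformation M)
    (P : bivector M) (hP : is_poisson_bivector D P)
    (htau : exists tau : {linear alg D -> (base D)^o},
       is_trace tau /\
       forall (a : alg D) (z : R[i]),
         is_integral e (redk a) z -> is_mod_kap D z (tau a)) :
  (forall (c : charts M) I p, chart_dom c p -> ext_d (contract_form P e) c I p = 0) /\
  (forall G : christoffel M,
     is_connection G -> torsion_free G ->
     (forall (c : charts M) j I p, chart_dom c p -> nabla_form G e c j I p = 0) ->
     forall (c : charts M) i p, chart_dom c p ->
       \sum_j nabla_bivector G P c j i j p = 0).
Proof.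
have [tau [ttau itau]] := htau; have [bP _] := hP.
have div := chart_divergence he hP ttau itau.
split=> [c I p cp|G _ tG nG c i p cp]; first exact: ext_d_contract.
exact: (connection_divergence he bP div i tG nG cp).
Qed.
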